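(* Let $\phi \in C^1(\mathbb{R}^2,\mathbb{R})$ be a strictly star-shaped function with $\phi(0,0)<0$. Let $U\subset\mathbb{R}^2$ be a bounded set and put $\sigma := \sup\{\sqrt{x^2+y^2} : (x,y)\in U\}$. Assume that $\phi(x,y)\ge 0$ for every $(x,y)\notin U$, and that for every $r>\sigma$ the function $\phi$ does not vanish identically on the circle $\partial D_r=\{(x,y): x^2+y^2=r^2\}$. Then the planar system $$\dot x = y, \qquad \dot y = -x - y\,\phi(x,y)$$ has exactly one limit cycle, and this limit cycle attracts every non-constant solution.
   Context: Subscripts denote partial derivatives. A function $\phi\in C^1(\mathbb{R}^2,\mathbb{R})$ is called strictly star-shaped if $x\phi_x(x,y) + y\phi_y(x,y) \neq 0$ for every $(x,y)\neq(0,0)$. A limit cycle is an isolated non-constant periodic orbit of the system, i.e. a non-constant periodic orbit having a neighbourhood that contains no other periodic orbit; limit cycles are counted as orbits (closed curves in the plane). A limit cycle attracts a solution $\gamma(t)$ if the distance from $\gamma(t)$ to the cycle tends to $0$ as $t\to+\infty$. *)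

(* Defs.v *)
(* World: Stdlib reals with Coquelicot. *)
From Stdlib Require Import Reals.
From Coquelicot Require Import Coquelicot.
Open Scope R_scope.

(* [ex_diff_n phi 1] asks for continuity of [phi] and existence and (joint)
   continuity of both of its partial derivatives. *)
Definition is_C1 (phi : R -> R -> R) : Prop := forall x y, ex_diff_n phi 1 x y.

Definition strictly_star_shaped (phi : R -> R -> R) : Prop :=
  forall x y, (x, y) <> (0, 0) ->
    x * Derive (fun u => phi u y) x + y * Derive (fun v => phi x v) y <> 0.

Definition radii (U : R * R -> Prop) : R -> Prop :=
  fun r => exists x y, U (x, y) /\ r = sqrt (x ^ 2 + y ^ 2).

Definition bounded_set (U : R * R -> Prop) : Prop :=
  exists M, forall x y, U (x, y) -> sqrt (x ^ 2 + y ^ 2) <= M.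

Definition planar_field (phi : R -> R -> R) (p : R * R) : R * R :=
  (snd p, - fst p - snd p * phi (fst p) (snd p)).

Section Dynamics.

Variable F : R * R -> R * R.

Definition in_oint (a b : Rbar) (t : R) : Prop := Rbar_lt a t /\ Rbar_lt t b.

Definition solution_on (a b : Rbar) (gamma : R -> R * R) : Prop :=
  forall t, in_oint a b t ->
    is_derive (fun s => fst (gamma s)) t (fst (F (gamma t))) /\
    is_derive (fun s => snd (gamma s)) t (snd (F (gamma t))).

(* Values of [gamma] outside ]a, b[ are irrelevant. *)
Definition maximal_solution (a b : Rbar) (gamma : R -> R * R) : Prop :=
  Rbar_lt a b /\ solution_on a b gamma /\
  forall (a' b' : Rbar) (delta : R -> R * R),
    Rbar_le a' a -> Rbar_le b b' -> solution_on a' b' delta ->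
    (forall t, in_oint a b t -> delta t = gamma t) ->
    a' = a /\ b' = b.

Definition non_constant_on (a b : Rbar) (gamma : R -> R * R) : Prop :=
  exists s t, in_oint a b s /\ in_oint a b t /\ gamma s <> gamma t.

Definition periodic_orbit (C : R * R -> Prop) : Prop :=
  exists gamma : R -> R * R,
    solution_on m_infty p_infty gamma /\
    non_constant_on m_infty p_infty gamma /\
    (exists T, 0 < T /\ forall t, gamma (t + T) = gamma t) /\
    forall p, C p <-> exists t, gamma t = p.

Definition limit_cycle (C : R * R -> Prop) : Prop :=
  periodic_orbit C /\
  exists V : R * R -> Prop,
    open V /\ (forall p, C p -> V p) /\
    forall C', periodic_orbit C' -> (forall p, C' p -> V p) -> C' = C.

End Dynamics.

Definition dist_to_set (C : R * R -> Prop) (p : R * R) : R :=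
  real (Glb_Rbar (fun d => exists q, C q /\
    d = dist_euc (fst p) (snd p) (fst q) (snd q))).

Definition attracts (C : R * R -> Prop) (gamma : R -> R * R) : Prop :=
  is_lim (fun t => dist_to_set C (gamma t)) p_infty 0.

(* Main.v *)
Require Import Defs.
From Stdlib Require Import ZArith Reals Lra Lia Psatz.
From Stdlib Require Import Classical IndefiniteDescription.
From Stdlib Require Import FunctionalExtensionality PropExtensionality.
From Coquelicot Require Import Coquelicot.
Open Scope R_scope.

(** Put [x = exp r * cos s], [y = - (exp r * sin s)], so that [r] is the logarithm
    of the distance to the origin and [s] an angle measured clockwise, and write
    [psi r s] for [phi x y].  Away from the origin the system becomes

      [r' = - sin s ^ 2 * psi r s],   [s' = 1 - sin s * cos s * psi r s].

    As [phi] is negative at the origin and nonnegative far away, it cannot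
    decrease along a ray, so star-shapedness makes [psi] strictly increasing in
    [r] ([psi_r_pos]): negative for [r <= a], nonnegative for [b <= r].

    Where [s' > 0], an orbit is a graph [r = rho s] with slope
    [drho/ds = - sin s ^ 2 * psi / (1 - sin s * cos s * psi)].  The derivative of
    the right-hand side in [psi] is
    [- sin s ^ 2 / (1 - sin s * cos s * psi) ^ 2 <= 0], so the slope
    decreases with [r] and two graphs never move apart.  The map
    [rho 0 |-> rho (2 * PI)] is therefore 1-Lipschitz; it sends [[a, b]] into
    itself and has a fixed point, which is a closed star-shaped curve
    ([star_cycle_exists]).  Since the denominator may vanish, this is first done
    for a field whose denominator is bounded below by a small [e].  Along a
    solution of that field the angular speed never falls below [e]: if it did,
    the term [psi_r] of its derivative, multiplied by [1 / e], would make it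
    increase again.

    The closed curve yields a Lyapunov function for every other orbit, even where
    that orbit turns backwards: with [d = r - rho s], the formulas above give

      [d' = - sin s ^ 2 * (psi r s - psi (rho s) s) / (angular speed of rho at s)]

    ([cycle_gap_derive]), whose sign is opposite to that of [d].  Hence [|d|]
    does not increase, the orbit stays bounded and exists for all later times
    ([maximal_solution_global]).  The derivative of [d ^ 2] vanishes on the
    [x]-axis, but there [sin s * cos s] increases at unit speed, and a
    combination of the two functions shows that [d] tends to [0]
    ([cycle_gap_vanishes]).  On a periodic orbit [d] repeats its values, so
    [d = 0] and the orbit is the closed curve ([periodic_orbit_unique]); as there
    is no other periodic orbit at all, the curve is a limit cycle.

    The existence of solutions rests on Picard iteration for bounded Lipschitz
    planar fields ([picard]), applied to truncations of the fields above. *)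

(** * Calculus on an interval *)

Lemma is_derive_continuity_pt (f : R -> R) (t l : R) :
  is_derive f t l -> continuity_pt f t.
Proof.
intros H. apply derivable_continuous_pt. exists l. now apply is_derive_Reals.
Qed.

Lemma is_derive_continuous (f : R -> R) (t l : R) :
  is_derive f t l -> continuous f t.
Proof. intros H. apply (ex_derive_continuous f). now exists l. Qed.

Lemma mean_value (f df : R -> R) (u v : R) :
  (forall t, Rmin u v <= t <= Rmax u v -> is_derive f t (df t)) ->
  exists c, Rmin u v <= c <= Rmax u v /\ f v - f u = df c * (v - u).
Proof.
intros H. apply (MVT_gen f u v df); intros t Ht.
- apply H. lra.
- apply (is_derive_continuity_pt _ _ (df t)). now apply H.
Qed.

Lemma nonincreasing_of_derive (f df : R -> R) (u v : R) :
  u <= v ->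
  (forall t, u <= t <= v -> is_derive f t (df t)) ->
  (forall t, u <= t <= v -> df t <= 0) -> f v <= f u.
Proof.
intros Huv Hd Hs. destruct (mean_value f df u v) as [c [Hc E]].
- rewrite Rmin_left, Rmax_right by lra. exact Hd.
- rewrite Rmin_left, Rmax_right in Hc by lra.
  generalize (Hs c Hc). nra.
Qed.

Lemma derive_zero_const (f : R -> R) (u v : R) :
  (forall t, Rmin u v <= t <= Rmax u v -> is_derive f t 0) -> f v = f u.
Proof.
intros H. destruct (mean_value f (fun _ => 0) u v H) as [c [_ E]]. lra.
Qed.

(** If [f T < c], then [f] would be nondecreasing after the last time at which
    it is at least [c]. *)
Lemma barrier (f df : R -> R) (c T : R) :
  0 <= T ->
  (forall t, 0 <= t <= T -> is_derive f t (df t)) ->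
  c <= f 0 ->
  (forall t, 0 <= t <= T -> f t < c -> 0 <= df t) ->
  c <= f T.
Proof.
intros HT Hd H0 Hs. destruct (Rle_dec c (f T)) as [H|H]; [exact H|].
exfalso. apply Rnot_le_lt in H.
destruct (completeness (fun t => 0 <= t <= T /\ c <= f t)) as [t1 [Hub Hlub]].
{ exists T. intros t [Ht _]. lra. }
{ exists 0. split; [lra|exact H0]. }
assert (B0 : 0 <= t1) by (apply Hub; split; [lra|exact H0]).
assert (B1 : t1 <= T) by (apply Hlub; intros t [Ht _]; lra).
assert (Hc : c <= f t1).
{ destruct (Rle_dec c (f t1)) as [K|K]; [exact K|exfalso].
  apply Rnot_le_lt in K.
  assert (C := is_derive_continuity_pt _ _ _ (Hd t1 (conj B0 B1))).
  destruct (C (c - f t1)) as [eta [He Hn]]; [lra|].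
  assert (X : t1 <= t1 - eta); [|lra].
  apply Hlub. intros t [Ht1 Ht2].
  assert (t <= t1) by (apply Hub; split; assumption).
  destruct (Rle_dec t (t1 - eta)) as [Y|Y]; [exact Y|exfalso].
  destruct (Req_dec t t1) as [E|E]; [subst t; lra|].
  assert (D : Rabs (f t - f t1) < c - f t1).
  { apply Hn. split.
    - split; [exact I|]. intros E'. now apply E.
    - simpl. unfold Rdist. apply Rabs_def1; lra. }
  apply Rabs_def2 in D. lra. }
assert (L : t1 < T).
{ destruct B1 as [B1|B1]; [exact B1|]. subst t1. lra. }
destruct (MVT_cor2 f df t1 T L) as [t [E Ht]].
{ intros t Ht. apply is_derive_Reals. apply Hd. lra. }
assert (f t < c).
{ apply Rnot_le_lt. intros K. assert (t <= t1); [|lra].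
  apply Hub. split; [lra|exact K]. }
assert (0 <= df t) by (apply Hs; lra). nra.
Qed.

(** Multiplying by [exp (- K * t)] or [exp (K * t)] turns the bound into
    monotonicity.  The two points come in any order, so a zero propagates both
    forwards and backwards in time. *)
Lemma gronwall_zero (f df : R -> R) (K u v : R) :
  (forall t, Rmin u v <= t <= Rmax u v ->
     is_derive f t (df t) /\ 0 <= f t /\ Rabs (df t) <= K * f t) ->
  f u = 0 -> f v = 0.
Proof.
intros H Hu. apply Rle_antisym.
- destruct (Rle_dec u v) as [L|L].
  + rewrite Rmin_left, Rmax_right in H by lra.
    assert (D : f v * exp (- K * v) <= f u * exp (- K * u)).
    { apply (nonincreasing_of_derive (fun t => f t * exp (- K * t))
        (fun t => (df t - K * f t) * exp (- K * t))); [lra| |]; intros t Ht;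
        destruct (H t Ht) as [H1 [H2 H3]].
      - auto_derive; [now exists (df t)|].
        change (Derive _ t) with (Derive f t).
        rewrite (is_derive_unique _ _ _ H1). ring.
      - assert (P := exp_pos (- K * t)). apply Rabs_le_between in H3. nra. }
    rewrite Hu in D. assert (P := exp_pos (- K * v)). nra.
  + apply Rnot_le_lt in L. rewrite Rmin_right, Rmax_left in H by lra.
    assert (D : - f u * exp (K * u) <= - f v * exp (K * v)).
    { apply (nonincreasing_of_derive (fun t => - f t * exp (K * t))
        (fun t => - (df t + K * f t) * exp (K * t))); [lra| |]; intros t Ht;
        destruct (H t Ht) as [H1 [H2 H3]].
      - auto_derive; [now exists (df t)|].
        change (Derive _ t) with (Derive f t).
        rewrite (is_derive_unique _ _ _ H1). ring.
      - assert (P := exp_pos (K * t)). apply Rabs_le_between in H3. nra. }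
    rewrite Hu in D. assert (P := exp_pos (K * v)). nra.
- apply H. split; [apply Rmin_r|apply Rmax_r].
Qed.

Lemma exp_nondecreasing (x y : R) : x <= y -> exp x <= exp y.
Proof. intros [H| ->]; [left; now apply exp_increasing|lra]. Qed.

Lemma surjective_of_speed (f df : R -> R) (e : R) :
  0 < e -> (forall t, is_derive f t (df t)) -> (forall t, e <= df t) ->
  forall y, exists t, f t = y.
Proof.
intros He Hd Hs y. set (t := (Rabs (y - f 0)) / e).
assert (Ht : 0 <= t) by (apply Rdiv_le_0_compat; [apply Rabs_pos|exact He]).
assert (Et : e * t = Rabs (y - f 0)) by (unfold t; field; lra).
destruct (IVT_gen f (- t) t y) as [z [_ Hz]].
- intros z. apply (is_derive_continuity_pt _ _ _ (Hd z)).
- destruct (mean_value f df 0 t) as [c [_ Ec]]; [intros; apply Hd|].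
  destruct (mean_value f df (- t) 0) as [c' [_ Ec']]; [intros; apply Hd|].
  assert (X := Hs c). assert (X' := Hs c').
  assert (L : f (- t) <= y).
  { assert (e * t <= f 0 - f (- t)) by (rewrite Ec'; nra).
    generalize (Rle_abs (- (y - f 0))). rewrite Rabs_Ropp. lra. }
  assert (U : y <= f t).
  { assert (e * t <= f t - f 0) by (rewrite Ec; nra).
    generalize (Rle_abs (y - f 0)). lra. }
  rewrite Rmin_left, Rmax_right; lra.
- now exists z.
Qed.

Lemma in_oint_between (a b : Rbar) (u v t : R) :
  in_oint a b u -> in_oint a b v -> Rmin u v <= t <= Rmax u v -> in_oint a b t.
Proof.
intros [A1 B1] [A2 B2] [L H]. split.
- apply Rbar_lt_le_trans with (Rmin u v); [|exact L].
  unfold Rmin. now destruct (Rle_dec u v).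
- apply Rbar_le_lt_trans with (Rmax u v); [exact H|].
  unfold Rmax. now destruct (Rle_dec u v).
Qed.

Lemma in_oint_open (a b : Rbar) (t : R) :
  in_oint a b t -> locally t (in_oint a b).
Proof.
intros [A B]. apply filter_and.
- exact (open_Rbar_gt' (Finite t) a A).
- exact (open_Rbar_lt' (Finite t) b B).
Qed.

Lemma is_derive_RInt_oint (a b : Rbar) (k : R -> R) (c t0 : R) :
  in_oint a b t0 -> (forall t, in_oint a b t -> continuous k t) ->
  forall t, in_oint a b t -> is_derive (fun t => c + RInt k t0 t) t (k t).
Proof.
intros H0 Hk t Ht. rewrite <- (Rplus_0_l (k t)).
apply (is_derive_plus (fun _ => c) (fun s => RInt k t0 s) t 0 (k t)).
- apply (is_derive_const c).
- apply (is_derive_RInt k _ t0 t); [|now apply Hk].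
  generalize (in_oint_open a b t Ht). apply filter_imp. intros u Hu.
  apply (RInt_correct (V := R_CompleteNormedModule)).
  apply (ex_RInt_continuous (V := R_CompleteNormedModule)).
  intros z Hz. apply Hk. now apply (in_oint_between a b t0 u).
Qed.

(** * Bounded Lipschitz functions of two variables *)

(** Boundedness is what makes this class closed under products; fields in it
    have solutions on the whole line. *)
Definition bdd_lipschitz (f : R -> R -> R) : Prop :=
  exists K, 0 <= K /\ (forall x y, Rabs (f x y) <= K) /\
    forall x y x' y',
      Rabs (f x y - f x' y') <= K * (Rabs (x - x') + Rabs (y - y')).

Lemma bl_intro (f : R -> R -> R) (B L : R) :
  (forall x y, Rabs (f x y) <= B) ->
  (forall x y x' y',
      Rabs (f x y - f x' y') <= L * (Rabs (x - x') + Rabs (y - y'))) ->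
  bdd_lipschitz f.
Proof.
intros H1 H2. exists (Rmax (Rmax B L) 0).
assert (M1 := Rmax_l B L). assert (M2 := Rmax_r B L).
assert (M3 := Rmax_l (Rmax B L) 0). assert (M4 := Rmax_r (Rmax B L) 0).
split; [exact M4|split].
- intros x y. generalize (H1 x y). lra.
- intros x y x' y'. eapply Rle_trans; [apply H2|].
  apply Rmult_le_compat_r; [|lra].
  generalize (Rabs_pos (x - x')) (Rabs_pos (y - y')). lra.
Qed.

Lemma bl_ext (f g : R -> R -> R) :
  (forall x y, f x y = g x y) -> bdd_lipschitz f -> bdd_lipschitz g.
Proof.
intros E [K [K0 [B L]]]. exists K. split; [exact K0|split]; intros;
  rewrite <- ?E; auto.
Qed.

Lemma bl_const (c : R) : bdd_lipschitz (fun _ _ => c).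
Proof.
apply (bl_intro _ (Rabs c) 0); intros; [lra|].
replace (c - c) with 0 by ring. rewrite Rabs_R0. lra.
Qed.

Lemma bl_swap (f : R -> R -> R) :
  bdd_lipschitz f -> bdd_lipschitz (fun x y => f y x).
Proof.
intros [K [K0 [B L]]]. exists K. split; [exact K0|split]; intros; auto.
rewrite (Rplus_comm (Rabs (x - x'))). apply L.
Qed.

Lemma bl_plus (f g : R -> R -> R) :
  bdd_lipschitz f -> bdd_lipschitz g -> bdd_lipschitz (fun x y => f x y + g x y).
Proof.
intros [K [K0 [B L]]] [K' [K0' [B' L']]]. apply (bl_intro _ (K + K') (K + K')).
- intros x y. eapply Rle_trans; [apply Rabs_triang|].
  generalize (B x y) (B' x y). lra.
- intros x y x' y'.
  replace (f x y + g x y - (f x' y' + g x' y'))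
    with ((f x y - f x' y') + (g x y - g x' y')) by ring.
  eapply Rle_trans; [apply Rabs_triang|].
  generalize (L x y x' y') (L' x y x' y'). lra.
Qed.

Lemma bl_mult (f g : R -> R -> R) :
  bdd_lipschitz f -> bdd_lipschitz g -> bdd_lipschitz (fun x y => f x y * g x y).
Proof.
intros [K [K0 [B L]]] [K' [K0' [B' L']]].
apply (bl_intro _ (K * K') (2 * (K * K'))).
- intros x y. rewrite Rabs_mult.
  apply Rmult_le_compat; auto using Rabs_pos.
- intros x y x' y'.
  replace (f x y * g x y - f x' y' * g x' y')
    with ((f x y - f x' y') * g x y + f x' y' * (g x y - g x' y')) by ring.
  eapply Rle_trans; [apply Rabs_triang|]. rewrite !Rabs_mult.
  assert (X1 := Rmult_le_compat _ _ _ _ (Rabs_pos _) (Rabs_pos _)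
    (L x y x' y') (B' x y)).
  assert (X2 := Rmult_le_compat _ _ _ _ (Rabs_pos _) (Rabs_pos _)
    (B x' y') (L' x y x' y')).
  nra.
Qed.

Lemma bl_opp (f : R -> R -> R) :
  bdd_lipschitz f -> bdd_lipschitz (fun x y => - f x y).
Proof.
intros H. apply (bl_ext (fun x y => (-1) * f x y)); [intros; ring|].
apply bl_mult; [apply bl_const|exact H].
Qed.

Lemma bl_minus (f g : R -> R -> R) :
  bdd_lipschitz f -> bdd_lipschitz g -> bdd_lipschitz (fun x y => f x y - g x y).
Proof. intros Hf Hg. apply bl_plus; [exact Hf|now apply bl_opp]. Qed.

Lemma bl_comp (f g h : R -> R -> R) :
  bdd_lipschitz f -> bdd_lipschitz g -> bdd_lipschitz h ->
  bdd_lipschitz (fun x y => f (g x y) (h x y)).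
Proof.
intros [K [K0 [B L]]] [K1 [K01 [B1 L1]]] [K2 [K02 [B2 L2]]].
apply (bl_intro _ K (K * (K1 + K2))).
- intros x y. apply B.
- intros x y x' y'. eapply Rle_trans; [apply L|].
  rewrite Rmult_assoc. apply Rmult_le_compat_l; [exact K0|].
  generalize (L1 x y x' y') (L2 x y x' y'). lra.
Qed.

(** Truncating a denominator from below keeps a quotient in the class. *)
Lemma bl_inv_max (f : R -> R -> R) (e : R) :
  0 < e -> bdd_lipschitz f -> bdd_lipschitz (fun x y => / Rmax (f x y) e).
Proof.
intros He [K [K0 [B L]]].
apply (bl_intro _ (/ e) (K * (/ e * / e))).
- intros x y. assert (M := Rmax_r (f x y) e).
  rewrite Rabs_pos_eq; [|left; apply Rinv_0_lt_compat; lra].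
  apply Rinv_le_contravar; lra.
- intros x y x' y'.
  assert (M := Rmax_r (f x y) e). assert (M' := Rmax_r (f x' y') e).
  replace (/ Rmax (f x y) e - / Rmax (f x' y') e)
    with ((Rmax (f x' y') e - Rmax (f x y) e) *
          (/ Rmax (f x y) e * / Rmax (f x' y') e)) by (field; lra).
  rewrite Rabs_mult.
  rewrite (Rabs_pos_eq (/ _ * / _)); [|left; apply Rmult_lt_0_compat;
    apply Rinv_0_lt_compat; lra].
  replace (K * (/ e * / e) * (Rabs (x - x') + Rabs (y - y'))) with
    (K * (Rabs (x - x') + Rabs (y - y')) * (/ e * / e)) by ring.
  apply Rmult_le_compat.
  + apply Rabs_pos.
  + left; apply Rmult_lt_0_compat; apply Rinv_0_lt_compat; lra.
  + eapply Rle_trans; [|apply L]. rewrite (Rabs_minus_sym (f x y)).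
    generalize (Rabs_pos (f x' y' - f x y)). generalize (f x y), (f x' y').
    intros u v _. unfold Rmax, Rabs.
    repeat destruct (Rle_dec _ _); repeat destruct (Rcase_abs _); lra.
  + apply Rmult_le_compat; try (left; apply Rinv_0_lt_compat; lra);
      apply Rinv_le_contravar; lra.
Qed.

Definition clamp (a b r : R) : R := Rmax a (Rmin b r).

Lemma clamp_id (a b r : R) : a <= r <= b -> clamp a b r = r.
Proof. intros H. unfold clamp. rewrite Rmin_right, Rmax_right; lra. Qed.

Lemma clamp_bound (a b r : R) : a <= b -> a <= clamp a b r <= b.
Proof.
intros H. unfold clamp, Rmax, Rmin.
destruct (Rle_dec b r); destruct (Rle_dec a _); lra.
Qed.

Lemma clamp_incr (a b r r' : R) : r <= r' -> clamp a b r <= clamp a b r'.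
Proof.
intros H. unfold clamp, Rmax, Rmin.
destruct (Rle_dec b r); destruct (Rle_dec b r'); repeat destruct (Rle_dec a _); lra.
Qed.

Lemma clamp_lipschitz (a b r r' : R) :
  Rabs (clamp a b r - clamp a b r') <= Rabs (r - r').
Proof.
unfold clamp, Rmax, Rmin, Rabs.
destruct (Rle_dec b r); destruct (Rle_dec b r'); repeat destruct (Rle_dec a _);
  repeat destruct (Rcase_abs _); lra.
Qed.

Lemma bl_clamped (f df : R -> R) (a b K : R) :
  a <= b ->
  (forall t, a <= t <= b -> is_derive f t (df t) /\ Rabs (df t) <= K) ->
  bdd_lipschitz (fun x _ => f (clamp a b x)).
Proof.
intros Hab H.
assert (L : forall u v, a <= u <= b -> a <= v <= b ->
          Rabs (f u - f v) <= K * Rabs (u - v)).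
{ intros u v Hu Hv.
  assert (M1 : a <= Rmin v u) by (apply Rmin_glb; lra).
  assert (M2 : Rmax v u <= b) by (apply Rmax_lub; lra).
  destruct (mean_value f df v u) as [c [Hc E]].
  { intros t Ht. apply H. lra. }
  rewrite E, Rabs_mult. apply Rmult_le_compat_r; [apply Rabs_pos|].
  apply H. lra. }
assert (K0 : 0 <= K).
{ destruct (H a) as [_ X]; [lra|]. generalize (Rabs_pos (df a)). lra. }
apply (bl_intro _ (Rabs (f a) + K * (b - a)) K).
- intros x _. assert (C := clamp_bound a b x Hab).
  assert (X := L (clamp a b x) a C ltac:(lra)).
  replace (f (clamp a b x)) with (f a + (f (clamp a b x) - f a)) by ring.
  eapply Rle_trans; [apply Rabs_triang|]. apply Rplus_le_compat_l.
  eapply Rle_trans; [exact X|]. apply Rmult_le_compat_l; [exact K0|].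
  rewrite Rabs_pos_eq; lra.
- intros x y x' y'.
  eapply Rle_trans; [apply L; apply clamp_bound; exact Hab|].
  apply Rmult_le_compat_l; [exact K0|].
  generalize (clamp_lipschitz a b x x') (Rabs_pos (y - y')). lra.
Qed.

Lemma bl_of_derive (f df : R -> R) (B K : R) :
  (forall t, Rabs (f t) <= B) ->
  (forall t, is_derive f t (df t)) -> (forall t, Rabs (df t) <= K) ->
  bdd_lipschitz (fun _ s => f s).
Proof.
intros HB Hd HK. apply (bl_intro _ B K); [intros; apply HB|].
intros x y x' y'. destruct (mean_value f df y' y) as [c [_ E]].
{ intros; apply Hd. }
rewrite E, Rabs_mult.
assert (K0 : 0 <= K) by (generalize (HK 0) (Rabs_pos (df 0)); lra).
generalize (HK c) (Rabs_pos (df c)) (Rabs_pos (x - x')) (Rabs_pos (y - y')).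
intros. nra.
Qed.

Lemma bl_sin : bdd_lipschitz (fun _ s => sin s).
Proof.
apply (bl_of_derive sin cos 1 1); intros t.
- apply Rabs_le. generalize (SIN_bound t). lra.
- apply is_derive_Reals, derivable_pt_lim_sin.
- apply Rabs_le. generalize (COS_bound t). lra.
Qed.

Lemma bl_cos : bdd_lipschitz (fun _ s => cos s).
Proof.
apply (bl_of_derive cos (fun s => - sin s) 1 1); intros t.
- apply Rabs_le. generalize (COS_bound t). lra.
- apply is_derive_Reals, derivable_pt_lim_cos.
- rewrite Rabs_Ropp. apply Rabs_le. generalize (SIN_bound t). lra.
Qed.

Lemma bl_continuous (G : R -> R -> R) (x y : R -> R) (t : R) :
  bdd_lipschitz G -> continuous x t -> continuous y t ->
  continuous (fun s => G (x s) (y s)) t.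
Proof.
intros [K [K0 [_ L]]] Hx Hy. apply filterlim_locally. intros eps.
assert (P : 0 < eps / (2 * (K + 1))).
{ apply Rdiv_lt_0_compat; [apply eps|lra]. }
assert (Lx := proj1 (filterlim_locally _ _) Hx (mkposreal _ P)).
assert (Ly := proj1 (filterlim_locally _ _) Hy (mkposreal _ P)).
generalize (filter_and _ _ Lx Ly). apply filter_imp. intros s [Bx By].
change (Rabs (x s - x t) < eps / (2 * (K + 1))) in Bx.
change (Rabs (y s - y t) < eps / (2 * (K + 1))) in By.
change (Rabs (G (x s) (y s) - G (x t) (y t)) < eps).
eapply Rle_lt_trans; [apply L|].
apply Rle_lt_trans with (K * (2 * (eps / (2 * (K + 1))))).
- apply Rmult_le_compat_l; lra.
- replace (K * (2 * (eps / (2 * (K + 1))))) with (eps * (K / (K + 1)))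
    by (field; lra).
  rewrite <- (Rmult_1_r eps) at 2. apply Rmult_lt_compat_l; [apply eps|].
  apply Rmult_lt_reg_r with (K + 1); [lra|]. field_simplify; lra.
Qed.

(** * Existence and uniqueness for planar differential equations *)

(** The squared distance of two solutions satisfies the hypothesis of
    [gronwall_zero]. *)
Lemma ode_unique (G1 G2 : R -> R -> R) (x y x' y' : R -> R) (u v : R) :
  bdd_lipschitz G1 -> bdd_lipschitz G2 ->
  (forall t, Rmin u v <= t <= Rmax u v ->
     is_derive x t (G1 (x t) (y t)) /\ is_derive y t (G2 (x t) (y t))) ->
  (forall t, Rmin u v <= t <= Rmax u v ->
     is_derive x' t (G1 (x' t) (y' t)) /\ is_derive y' t (G2 (x' t) (y' t))) ->
  x u = x' u -> y u = y' u -> x v = x' v /\ y v = y' v.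
Proof.
intros [K1 [P1 [_ L1]]] [K2 [P2 [_ L2]]] H H' Ex Ey.
assert (Z : (x v - x' v) ^ 2 + (y v - y' v) ^ 2 = 0).
{ apply (gronwall_zero (fun t => (x t - x' t) ^ 2 + (y t - y' t) ^ 2)
    (fun t => 2 * (x t - x' t) * (G1 (x t) (y t) - G1 (x' t) (y' t)) +
              2 * (y t - y' t) * (G2 (x t) (y t) - G2 (x' t) (y' t)))
    (4 * (K1 + K2)) u v).
  - intros t Ht. destruct (H t Ht) as [A B]. destruct (H' t Ht) as [A' B'].
    split; [|split].
    + auto_derive.
      * repeat split; eexists; eassumption.
      * change (Derive (fun x0 => x x0) t) with (Derive x t).
        change (Derive (fun x0 => x' x0) t) with (Derive x' t).
        change (Derive (fun x0 => y x0) t) with (Derive y t).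
        change (Derive (fun x0 => y' x0) t) with (Derive y' t).
        rewrite (is_derive_unique x _ _ A), (is_derive_unique x' _ _ A'),
          (is_derive_unique y _ _ B), (is_derive_unique y' _ _ B'). ring.
    + apply Rplus_le_le_0_compat; apply pow2_ge_0.
    + assert (Q1 := L1 (x t) (y t) (x' t) (y' t)).
      assert (Q2 := L2 (x t) (y t) (x' t) (y' t)).
      revert Q1 Q2. generalize (G1 (x t) (y t) - G1 (x' t) (y' t)),
        (G2 (x t) (y t) - G2 (x' t) (y' t)).
      rewrite <- (pow2_abs (x t - x' t)), <- (pow2_abs (y t - y' t)).
      intros g1 g2 Q1 Q2.
      eapply Rle_trans; [apply Rabs_triang|]. rewrite !Rabs_mult.
      rewrite (Rabs_pos_eq 2) by lra.
      assert (p := Rabs_pos (x t - x' t)). assert (q := Rabs_pos (y t - y' t)).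
      revert p q Q1 Q2.
      generalize (Rabs (x t - x' t)), (Rabs (y t - y' t)). intros a b p q Q1 Q2.
      apply Rle_trans with (2 * a * (K1 * (a + b)) + 2 * b * (K2 * (a + b))).
      * apply Rplus_le_compat; apply Rmult_le_compat_l; lra.
      * assert (0 <= K1 * (a - b) ^ 2) by (apply Rmult_le_pos; [assumption|apply pow2_ge_0]).
        assert (0 <= K2 * (a - b) ^ 2) by (apply Rmult_le_pos; [assumption|apply pow2_ge_0]).
        assert (0 <= K1 * a ^ 2) by (apply Rmult_le_pos; [assumption|apply pow2_ge_0]).
        assert (0 <= K2 * a ^ 2) by (apply Rmult_le_pos; [assumption|apply pow2_ge_0]).
        assert (0 <= K1 * b ^ 2) by (apply Rmult_le_pos; [assumption|apply pow2_ge_0]).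
        assert (0 <= K2 * b ^ 2) by (apply Rmult_le_pos; [assumption|apply pow2_ge_0]).
        nra.
  - simpl. rewrite Ex, Ey. ring. }
assert (S1 := pow2_ge_0 (x v - x' v)). assert (S2 := pow2_ge_0 (y v - y' v)).
split; apply Rminus_diag_uniq, Rsqr_0_uniq; rewrite Rsqr_pow2; lra.
Qed.

Lemma div_pow2_small (C e : R) : 0 < e -> exists n, C / 2 ^ n < e.
Proof.
intros He.
destruct (pow_lt_1_zero (/ 2) ltac:(rewrite Rabs_pos_eq; lra) (e / (Rabs C + 1)))
  as [n Hn].
{ apply Rdiv_lt_0_compat; [exact He|]. generalize (Rabs_pos C). lra. }
exists n. specialize (Hn n (le_n _)).
assert (P : 0 < / 2 ^ n) by (apply Rinv_0_lt_compat, pow_lt; lra).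
rewrite pow_inv, Rabs_pos_eq in Hn by lra.
apply Rle_lt_trans with ((Rabs C + 1) * / 2 ^ n).
- apply Rmult_le_compat_r; [lra|]. generalize (Rle_abs C). lra.
- apply Rlt_le_trans with ((Rabs C + 1) * (e / (Rabs C + 1))).
  + apply Rmult_lt_compat_l; [generalize (Rabs_pos C); lra|exact Hn].
  + right. field. generalize (Rabs_pos C). lra.
Qed.

Lemma geometric_small (z C : R) : (forall n, Rabs z <= C / 2 ^ n) -> z = 0.
Proof.
intros H. destruct (Req_dec z 0) as [E|E]; [exact E|exfalso].
destruct (div_pow2_small C (Rabs z) (Rabs_pos_lt z E)) as [n Hn].
generalize (H n). lra.
Qed.

(** The intervals centred at [u n] with radius [2 * C / 2 ^ n] are nested. *)
Lemma geometric_limit (u : nat -> R) (C : R) :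
  (forall n, Rabs (u (S n) - u n) <= C / 2 ^ n) ->
  forall n, Rabs (u n - real (Lim_seq u)) <= 2 * C / 2 ^ n.
Proof.
intros H.
assert (P : forall n, 0 < 2 ^ n) by (intros; apply pow_lt; lra).
assert (C0 : 0 <= C).
{ generalize (H 0%nat) (Rabs_pos (u 1%nat - u 0%nat)). simpl. lra. }
assert (E : forall n, 2 * C / 2 ^ n - 2 * C / 2 ^ S n = C / 2 ^ n).
{ intros n. simpl. field. generalize (P n). lra. }
set (lo := fun n => u n - 2 * C / 2 ^ n).
set (hi := fun n => u n + 2 * C / 2 ^ n).
assert (Hlo : forall n m, (n <= m)%nat -> lo n <= lo m).
{ intros n m L. induction L as [|m L IH]; [lra|].
  generalize (H m) (E m). intros X Y. apply Rabs_le_between in X.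
  unfold lo in *. lra. }
assert (Hhi : forall n m, (n <= m)%nat -> hi m <= hi n).
{ intros n m L. induction L as [|m L IH]; [lra|].
  generalize (H m) (E m). intros X Y. apply Rabs_le_between in X.
  unfold hi in *. lra. }
assert (Hlh : forall n, lo n <= hi n).
{ intros n. unfold lo, hi. assert (0 <= 2 * C / 2 ^ n); [|lra].
  apply Rdiv_le_0_compat; [lra|apply P]. }
assert (A : forall n m, lo n <= hi m).
{ intros n m. destruct (Nat.le_ge_cases n m) as [L|L].
  - generalize (Hlo n m L) (Hlh m). lra.
  - generalize (Hhi m n L) (Hlh n). lra. }
destruct (completeness (fun z => exists n, z = lo n)) as [l [Hub Hlub]].
{ exists (hi 0%nat). intros z [n ->]. apply A. }
{ exists (lo 0%nat). now exists 0%nat. }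
assert (B : forall n, Rabs (u n - l) <= 2 * C / 2 ^ n).
{ intros n. apply Rabs_le.
  assert (lo n <= l) by (apply Hub; now exists n).
  assert (l <= hi n) by (apply Hlub; intros z [m ->]; apply A).
  unfold lo, hi in *. lra. }
enough (L : is_lim_seq u l) by (rewrite (is_lim_seq_unique _ _ L); exact B).
assert (G : is_lim_seq (fun n => 2 * C / 2 ^ n) 0).
{ apply (is_lim_seq_ext (fun n => 2 * C * (/ 2) ^ n)).
  - intros n. now rewrite pow_inv.
  - replace 0 with (2 * C * 0) by ring.
    apply (is_lim_seq_scal_l _ (2 * C) 0), is_lim_seq_geom.
    rewrite Rabs_pos_eq; lra. }
apply (is_lim_seq_le_le (fun n => l - 2 * C / 2 ^ n) u (fun n => l + 2 * C / 2 ^ n)).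
- intros n. specialize (B n). apply Rabs_le_between in B. lra.
- assert (G' := is_lim_seq_minus' _ _ _ _ (is_lim_seq_const l) G).
  rewrite Rminus_0_r in G'. exact G'.
- assert (G' := is_lim_seq_plus' _ _ _ _ (is_lim_seq_const l) G).
  rewrite Rplus_0_r in G'. exact G'.
Qed.

(** Integration of a function of weighted size [c] divides the size by [l]:
    a large [l] makes integral operators contracting. *)
Lemma exp_growth (f df : R -> R) (c l : R) :
  0 < l -> f 0 = 0 ->
  (forall t, is_derive f t (df t)) ->
  (forall t, Rabs (df t) <= c * exp (l * Rabs t)) ->
  forall t, Rabs (f t) <= c / l * exp (l * Rabs t).
Proof.
intros Hl.
assert (half : forall (g dg : R -> R), g 0 = 0 ->
  (forall t, 0 <= t -> is_derive g t (dg t)) ->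
  (forall t, 0 <= t -> dg t <= c * exp (l * t)) ->
  0 <= c ->
  forall t, 0 <= t -> g t <= c / l * exp (l * t)).
{ intros g dg g0 Hd Hb Hc t Ht.
  assert (X : g t - c / l * exp (l * t) <= g 0 - c / l * exp (l * 0)).
  { apply (nonincreasing_of_derive (fun t => g t - c / l * exp (l * t))
      (fun t => dg t - c * exp (l * t))); [exact Ht| |]; intros s Hs.
    - auto_derive; [exists (dg s); apply Hd; lra|].
      change (Derive (fun x => g x) s) with (Derive g s).
      rewrite (is_derive_unique g _ _ (Hd s ltac:(lra))). field. lra.
    - generalize (Hb s ltac:(lra)). lra. }
  rewrite g0, Rmult_0_r, exp_0 in X.
  assert (0 <= c / l) by (apply Rdiv_le_0_compat; lra). lra. }
intros f0 Hd Hb t.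
assert (Hc : 0 <= c).
{ generalize (Hb 0) (Rabs_pos (df 0)). rewrite Rabs_R0, Rmult_0_r, exp_0. lra. }
assert (Dm : forall s, is_derive (fun r => f (- r)) s (- df (- s))).
{ intros s. auto_derive; [now exists (df (- s))|].
  change (Derive (fun x => f x) (- s)) with (Derive f (- s)).
  rewrite (is_derive_unique f _ _ (Hd (- s))). ring. }
assert (Bm : forall s, Rabs (- df (- s)) <= c * exp (l * Rabs s)).
{ intros s. rewrite Rabs_Ropp, <- (Rabs_Ropp s). apply Hb. }
assert (neg : forall (g dg : R -> R) s, is_derive g s (dg s) ->
  is_derive (fun r => - g r) s (- dg s)).
{ intros g dg s Hg. now apply (is_derive_opp g). }
destruct (Rle_dec 0 t) as [L|L].
- rewrite (Rabs_pos_eq t L). apply Rabs_le. split.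
  + assert (- f t <= c / l * exp (l * t)); [|lra].
    apply (half (fun t => - f t) (fun t => - df t)); auto; [lra|].
    intros s Hs. generalize (Hb s). rewrite (Rabs_pos_eq s Hs).
    intros X. apply Rabs_le_between in X. lra.
  + apply (half f df); auto.
    intros s Hs. generalize (Hb s). rewrite (Rabs_pos_eq s Hs).
    intros X. apply Rabs_le_between in X. lra.
- rewrite <- (Rabs_Ropp t), (Rabs_pos_eq (- t)) by lra.
  rewrite <- (Ropp_involutive t) at 1. apply Rabs_le. split.
  + assert (- f (- - t) <= c / l * exp (l * - t)); [|lra].
    apply (half (fun t => - f (- t)) (fun t => - - df (- t))); [| | |exact Hc|lra].
    * rewrite Ropp_0. lra.
    * intros s _. apply (neg (fun r => f (- r)) (fun r => - df (- r))), Dm.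
    * intros s Hs. generalize (Bm s). rewrite (Rabs_pos_eq s Hs).
      intros X. apply Rabs_le_between in X. lra.
  + apply (half (fun t => f (- t)) (fun t => - df (- t))); [| | |exact Hc|lra].
    * rewrite Ropp_0. lra.
    * intros s _. apply Dm.
    * intros s Hs. generalize (Bm s). rewrite (Rabs_pos_eq s Hs).
      intros X. apply Rabs_le_between in X. lra.
Qed.

Section Picard.

Variables (G1 G2 : R -> R -> R) (x0 y0 : R).
Hypothesis G1_bl : bdd_lipschitz G1.
Hypothesis G2_bl : bdd_lipschitz G2.

Definition picard_step (G : R -> R -> R) (c : R) (x y : R -> R) : R -> R :=
  fun t => c + RInt (fun s => G (x s) (y s)) 0 t.

Fixpoint picard_iter (n : nat) : (R -> R) * (R -> R) :=
  match n with
  | O => (fun _ => x0, fun _ => y0)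
  | S n => let (x, y) := picard_iter n in
           (picard_step G1 x0 x y, picard_step G2 y0 x y)
  end.

Lemma picard_step_derive G c x y :
  bdd_lipschitz G ->
  (forall t, continuous x t) -> (forall t, continuous y t) ->
  forall t, is_derive (picard_step G c x y) t (G (x t) (y t)).
Proof.
intros HG Hx Hy t.
apply (is_derive_RInt_oint m_infty p_infty (fun s => G (x s) (y s))); [now split| |now split].
intros u _. now apply bl_continuous.
Qed.

Lemma picard_step_0 G c x y : picard_step G c x y 0 = c.
Proof. unfold picard_step. rewrite RInt_point. apply Rplus_0_r. Qed.

(** Measuring distances with the weight [exp (4 * K * |t|)] makes the step a
    contraction on the whole line at once: each of the two components gains a
    factor [1 / 4], so their sum gains [1 / 2]. *)
Lemma picard_step_contract G c x y x' y' K D :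
  0 < K ->
  (forall u v u' v',
      Rabs (G u v - G u' v') <= K * (Rabs (u - u') + Rabs (v - v'))) ->
  bdd_lipschitz G ->
  (forall t, continuous x t) -> (forall t, continuous y t) ->
  (forall t, continuous x' t) -> (forall t, continuous y' t) ->
  (forall t, Rabs (x t - x' t) + Rabs (y t - y' t) <= D * exp (4 * K * Rabs t)) ->
  forall t, Rabs (picard_step G c x y t - picard_step G c x' y' t)
            <= D / 4 * exp (4 * K * Rabs t).
Proof.
intros HK L HG Hx Hy Hx' Hy' HD t.
replace (D / 4) with (K * D / (4 * K)) by (field; lra).
apply (exp_growth (fun t => picard_step G c x y t - picard_step G c x' y' t)
   (fun t => G (x t) (y t) - G (x' t) (y' t))).
- lra.
- rewrite !picard_step_0. ring.
- intros s. apply (is_derive_minus (picard_step G c x y) (picard_step G c x' y'));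
    now apply picard_step_derive.
- intros s. eapply Rle_trans; [apply L|]. rewrite Rmult_assoc.
  apply Rmult_le_compat_l; [lra|apply HD].
Qed.

(** Consecutive iterates differ by a geometric sequence in the weighted size.
    Their limit is Lipschitz, because the field is bounded, and it is a fixed
    point of the step, hence differentiable. *)
Theorem picard :
  exists x y : R -> R, x 0 = x0 /\ y 0 = y0 /\
    forall t, is_derive x t (G1 (x t) (y t)) /\ is_derive y t (G2 (x t) (y t)).
Proof.
destruct G1_bl as [K1 [P1 [B1 L1]]]. destruct G2_bl as [K2 [P2 [B2 L2]]].
set (K := K1 + K2 + 1).
assert (HK : 0 < K) by (unfold K; lra).
assert (LL : forall G k, k <= K -> (forall u v u' v',
      Rabs (G u v - G u' v') <= k * (Rabs (u - u') + Rabs (v - v'))) ->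
  forall u v u' v' : R,
      Rabs (G u v - G u' v') <= K * (Rabs (u - u') + Rabs (v - v'))).
{ intros G k Hk L u v u' v'. eapply Rle_trans; [apply L|].
  apply Rmult_le_compat_r; [|exact Hk].
  generalize (Rabs_pos (u - u')) (Rabs_pos (v - v')). lra. }
assert (LL1 := LL G1 K1 ltac:(unfold K; lra) L1).
assert (LL2 := LL G2 K2 ltac:(unfold K; lra) L2).
set (X := fun n => fst (picard_iter n)). set (Y := fun n => snd (picard_iter n)).
assert (XS : forall n, X (S n) = picard_step G1 x0 (X n) (Y n)).
{ intros n. unfold X, Y. simpl. now destruct (picard_iter n). }
assert (YS : forall n, Y (S n) = picard_step G2 y0 (X n) (Y n)).
{ intros n. unfold X, Y. simpl. now destruct (picard_iter n). }
assert (CXY : forall n, (forall t, continuous (X n) t) /\ (forall t, continuous (Y n) t)).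
{ induction n as [|n [IX IY]]; [split; intros t; apply continuous_const|].
  rewrite XS, YS. split; intros t;
    eapply is_derive_continuous; now apply picard_step_derive. }
set (E := fun t => exp (4 * K * Rabs t)).
assert (D : forall n t, Rabs (X (S n) t - X n t) + Rabs (Y (S n) t - Y n t)
            <= / 2 / 2 ^ n * E t).
{ induction n as [|n IH]; intros t.
  - rewrite XS, YS.
    assert (st : forall G c k, k <= K -> bdd_lipschitz G ->
        (forall u v, Rabs (G u v) <= k) ->
        Rabs (picard_step G c (X 0%nat) (Y 0%nat) t - c) <= K / (4 * K) * E t).
    { intros G c k Hk HG HB.
      apply (exp_growth (fun t => picard_step G c (X 0%nat) (Y 0%nat) t - c)
        (fun t => G (X 0%nat t) (Y 0%nat t))).
      - lra.
      - rewrite picard_step_0. ring.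
      - intros s. rewrite <- (Rminus_0_r (G _ _)).
        apply (is_derive_minus (picard_step G c (X 0%nat) (Y 0%nat)) (fun _ => c)).
        + apply picard_step_derive; [exact HG|apply CXY|apply CXY].
        + apply (is_derive_const c).
      - intros s. apply Rle_trans with (K * 1).
        + generalize (HB (X 0%nat s) (Y 0%nat s)). lra.
        + apply Rmult_le_compat_l; [lra|]. rewrite <- exp_0.
          assert (0 <= 4 * K * Rabs s) by (generalize (Rabs_pos s); nra).
          destruct H as [H| <-]; [left; now apply exp_increasing|lra]. }
    assert (S1 := st G1 x0 K1 ltac:(unfold K; lra) G1_bl B1).
    assert (S2 := st G2 y0 K2 ltac:(unfold K; lra) G2_bl B2).
    replace (K / (4 * K)) with (/ 4) in S1, S2 by (field; lra).
    change (X 0%nat t) with x0. change (Y 0%nat t) with y0. simpl. lra.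
  - rewrite (XS (S n)), (YS (S n)), (XS n), (YS n).
    assert (C1 := picard_step_contract G1 x0 (X (S n)) (Y (S n)) (X n) (Y n) K
      (/ 2 / 2 ^ n) HK LL1 G1_bl (proj1 (CXY _)) (proj2 (CXY _))
      (proj1 (CXY _)) (proj2 (CXY _)) IH t).
    assert (C2 := picard_step_contract G2 y0 (X (S n)) (Y (S n)) (X n) (Y n) K
      (/ 2 / 2 ^ n) HK LL2 G2_bl (proj1 (CXY _)) (proj2 (CXY _))
      (proj1 (CXY _)) (proj2 (CXY _)) IH t).
    rewrite (XS n), (YS n) in C1, C2. fold (E t) in C1, C2.
    replace (/ 2 / 2 ^ S n * E t) with
      (/ 2 / 2 ^ n / 4 * E t + / 2 / 2 ^ n / 4 * E t); [lra|].
    simpl. field. apply pow_nonzero. lra. }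
assert (lim : forall Z : nat -> R -> R,
  (forall n t, Rabs (Z (S n) t - Z n t) <= / 2 / 2 ^ n * E t) ->
  exists z : R -> R, forall n t, Rabs (Z n t - z t) <= E t / 2 ^ n).
{ intros Z HZ.
  exists (fun t => real (Lim_seq (fun n => Z n t))). intros n t.
  replace (E t / 2 ^ n) with (2 * (/ 2 * E t) / 2 ^ n)
    by (field; apply pow_nonzero; lra).
  apply (geometric_limit (fun n => Z n t)). intros m.
  eapply Rle_trans; [apply HZ|]. right. unfold Rdiv. ring. }
destruct (lim X) as [x Hx].
{ intros n t. generalize (D n t) (Rabs_pos (Y (S n) t - Y n t)). lra. }
destruct (lim Y) as [y Hy].
{ intros n t. generalize (D n t) (Rabs_pos (X (S n) t - X n t)). lra. }
assert (cont : forall (Z : nat -> R -> R) (z : R -> R) G c, bdd_lipschitz G ->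
  (forall n, Z (S n) = picard_step G c (X n) (Y n)) ->
  (forall n t, Rabs (Z n t - z t) <= E t / 2 ^ n) ->
  forall t, continuous z t).
{ intros Z z G c HG HZ Hz t. destruct (HG) as [k [k0 [B _]]].
  assert (Lip : forall u v, Rabs (z u - z v) <= k * Rabs (u - v)).
  { intros u v. apply le_epsilon. intros e He.
    destruct (div_pow2_small ((E u + E v) / 2) e He) as [N HN].
    assert (A1 := Hz (S N) u). assert (A2 := Hz (S N) v).
    assert (A3 : Rabs (Z (S N) u - Z (S N) v) <= k * Rabs (u - v)).
    { rewrite HZ.
      destruct (mean_value (picard_step G c (X N) (Y N))
        (fun t => G (X N t) (Y N t)) v u) as [s [_ Es]].
      - intros s _. apply picard_step_derive; [exact HG|apply CXY|apply CXY].
      - rewrite Es, Rabs_mult. apply Rmult_le_compat_r; [apply Rabs_pos|apply B]. }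
    assert (A4 : E u / 2 ^ S N + E v / 2 ^ S N < e).
    { replace (E u / 2 ^ S N + E v / 2 ^ S N) with ((E u + E v) / 2 / 2 ^ N)
        by (simpl; field; apply pow_nonzero; lra). exact HN. }
    replace (z u - z v) with
      (- (Z (S N) u - z u) + (Z (S N) u - Z (S N) v) + (Z (S N) v - z v)) by ring.
    eapply Rle_trans; [apply Rabs_triang|].
    assert (A5 := Rabs_triang (- (Z (S N) u - z u)) (Z (S N) u - Z (S N) v)).
    rewrite Rabs_Ropp in A5. lra. }
  apply filterlim_locally. intros eps.
  assert (P : 0 < eps / (k + 1)) by (apply Rdiv_lt_0_compat; [apply eps|lra]).
  exists (mkposreal _ P). intros s Hs.
  change (Rabs (s - t) < eps / (k + 1)) in Hs.
  change (Rabs (z s - z t) < eps).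
  eapply Rle_lt_trans; [apply Lip|].
  apply Rle_lt_trans with (k * (eps / (k + 1))).
  - apply Rmult_le_compat_l; lra.
  - apply Rlt_le_trans with ((k + 1) * (eps / (k + 1))).
    + apply Rmult_lt_compat_r; lra.
    + right. field. lra. }
assert (Cx := cont X x G1 x0 G1_bl XS Hx).
assert (Cy := cont Y y G2 y0 G2_bl YS Hy).
assert (fixed : forall (Z : nat -> R -> R) (z : R -> R) G c, bdd_lipschitz G ->
  (forall u v u' v',
      Rabs (G u v - G u' v') <= K * (Rabs (u - u') + Rabs (v - v'))) ->
  (forall n, Z (S n) = picard_step G c (X n) (Y n)) ->
  (forall n t, Rabs (Z n t - z t) <= E t / 2 ^ n) ->
  forall t, z t = picard_step G c x y t).
{ intros Z z G c HG L HZ Hz t. apply Rminus_diag_uniq.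
  apply (geometric_small _ (E t)). intros n.
  assert (A1 := Hz (S n) t). rewrite HZ in A1.
  assert (A2 : Rabs (picard_step G c (X n) (Y n) t - picard_step G c x y t)
     <= 2 / 2 ^ n / 4 * E t).
  { apply (picard_step_contract G c (X n) (Y n) x y K (2 / 2 ^ n)); auto;
      try apply CXY.
    intros s. fold (E s). generalize (Hx n s) (Hy n s). unfold Rdiv. lra. }
  replace (z t - picard_step G c x y t) with
    (- (picard_step G c (X n) (Y n) t - z t) +
     (picard_step G c (X n) (Y n) t - picard_step G c x y t)) by ring.
  eapply Rle_trans; [apply Rabs_triang|]. rewrite Rabs_Ropp.
  replace (E t / 2 ^ n) with (E t / 2 ^ S n + 2 / 2 ^ n / 4 * E t); [lra|].
  simpl. field. apply pow_nonzero. lra. }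
assert (Fx := fixed X x G1 x0 G1_bl LL1 XS Hx).
assert (Fy := fixed Y y G2 y0 G2_bl LL2 YS Hy).
exists x, y. split; [rewrite Fx; apply picard_step_0|].
split; [rewrite Fy; apply picard_step_0|].
intros t. split.
- apply (is_derive_ext (picard_step G1 x0 x y)); [intros s; now rewrite Fx|].
  now apply picard_step_derive.
- apply (is_derive_ext (picard_step G2 y0 x y)); [intros s; now rewrite Fy|].
  now apply picard_step_derive.
Qed.

End Picard.

(** * Continuous functions on a square *)

(** By uniform continuity, [f] varies by less than [1] over each of [S n] equal
    steps of the segment from the origin to [(x, y)], with [n] independent of
    [(x, y)]. *)
Lemma bounded_2d (f : R -> R -> R) (M : R) :
  (forall x y, continuity_2d_pt f x y) ->
  exists K, forall x y, Rabs x <= M -> Rabs y <= M -> Rabs (f x y) <= K.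
Proof.
intros Hf.
destruct (Rle_dec 0 M) as [HM|HM].
2:{ exists 0. intros x y Hx. generalize (Rabs_pos x). lra. }
destruct (uniform_continuity_2d f (- M) M (- M) M
  (fun x y _ _ => Hf x y) (mkposreal 1 Rlt_0_1)) as [d Hd].
simpl in Hd. destruct (nfloor_ex (M / d)) as [n Hn].
{ apply Rdiv_le_0_compat; [exact HM|apply d]. }
assert (Hn1 : M / INR (S n) < d).
{ assert (0 < INR (S n)) by (apply lt_0_INR; lia).
  rewrite S_INR in *. apply Rmult_lt_reg_r with (INR n + 1); [lra|].
  replace (M / (INR n + 1) * (INR n + 1)) with M by (field; lra).
  replace M with (M / d * d) by (field; generalize (cond_pos d); lra).
  rewrite (Rmult_comm d). apply Rmult_lt_compat_r; [apply d|lra]. }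
exists (Rabs (f 0 0) + INR (S n)). intros x y Hx Hy.
set (N := INR (S n)) in *.
assert (HN : 0 < N) by (apply lt_0_INR; lia).
assert (step : forall z, Rabs z <= M -> Rabs (z / N) < d).
{ intros z Hz. unfold Rdiv. rewrite Rabs_mult, (Rabs_pos_eq (/ N)).
  - apply Rle_lt_trans with (M / N); [|exact Hn1].
    apply Rmult_le_compat_r; [left; now apply Rinv_0_lt_compat|exact Hz].
  - left; now apply Rinv_0_lt_compat. }
assert (inside : forall z k, Rabs z <= M -> (k <= S n)%nat ->
   - M <= INR k * (z / N) <= M).
{ intros z k Hz Hk. apply Rabs_le_between. unfold Rdiv.
  replace (INR k * (z * / N)) with (z * (INR k * / N)) by ring.
  rewrite Rabs_mult. apply le_INR in Hk. fold N in Hk.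
  assert (0 <= INR k * / N <= 1).
  { split.
    - apply Rmult_le_pos; [apply pos_INR|left; now apply Rinv_0_lt_compat].
    - apply Rmult_le_reg_r with N; [exact HN|]. field_simplify; lra. }
  rewrite (Rabs_pos_eq (INR k * / N)) by lra.
  generalize (Rabs_pos z). nra. }
assert (walk : forall k, (k <= S n)%nat ->
  Rabs (f (INR k * (x / N)) (INR k * (y / N))) <= Rabs (f 0 0) + INR k).
{ induction k as [|k IH]; intros Hk.
  - simpl. rewrite !Rmult_0_l. lra.
  - assert (X := IH ltac:(lia)).
    assert (Z : Rabs (f (INR (S k) * (x / N)) (INR (S k) * (y / N)) -
                 f (INR k * (x / N)) (INR k * (y / N))) < 1).
    { apply Hd; try (apply inside; [assumption|lia]).
      - rewrite S_INR.
        replace ((INR k + 1) * (x / N) - INR k * (x / N)) with (x / N) by ring. auto.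
      - rewrite S_INR.
        replace ((INR k + 1) * (y / N) - INR k * (y / N)) with (y / N) by ring. auto. }
    assert (T := Rabs_triang_inv (f (INR (S k) * (x / N)) (INR (S k) * (y / N)))
      (f (INR k * (x / N)) (INR k * (y / N)))).
    rewrite (S_INR k) at 3. lra. }
generalize (walk (S n) (le_n _)). fold N.
replace (N * (x / N)) with x by (field; lra).
now replace (N * (y / N)) with y by (field; lra).
Qed.

Lemma positive_2d (f : R -> R -> R) (M : R) :
  (forall x y, continuity_2d_pt f x y) -> (forall x y, 0 < f x y) ->
  exists m, 0 < m /\ forall x y, Rabs x <= M -> Rabs y <= M -> m <= f x y.
Proof.
intros Hf Hp. destruct (bounded_2d (fun x y => / f x y) M) as [K HK].
{ intros x y. apply continuity_2d_pt_inv; [apply Hf|]. generalize (Hp x y). lra. }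
exists (/ (Rabs K + 1)). assert (P := Rabs_pos K). split.
- apply Rinv_0_lt_compat. lra.
- intros x y Hx Hy. rewrite <- (Rinv_inv (f x y)).
  apply Rinv_le_contravar; [now apply Rinv_0_lt_compat|].
  generalize (HK x y Hx Hy) (Rle_abs (/ f x y)) (Rle_abs K). lra.
Qed.

Lemma continuity_2d_pt_slice (f : R -> R -> R) (x y : R) :
  continuity_2d_pt f x y -> continuity_pt (fun u => f u y) x.
Proof.
intros H. apply continuity_pt_locally. intros eps. destruct (H eps) as [d Hd].
exists d. intros u Hu. apply Hd; [exact Hu|].
rewrite Rminus_diag, Rabs_R0. apply d.
Qed.

Lemma continuity_2d_pt_comp (f g h : R -> R -> R) (x y : R) :
  continuity_2d_pt f (g x y) (h x y) ->
  continuity_2d_pt g x y -> continuity_2d_pt h x y ->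
  continuity_2d_pt (fun u v => f (g u v) (h u v)) x y.
Proof.
rewrite !continuity_2d_pt_filterlim. intros Hf Hg Hh.
apply (continuous_comp_2 (fun z => g (fst z) (snd z)) (fun z => h (fst z) (snd z))
   f (x, y)); assumption.
Qed.

Lemma continuity_2d_pt_fst (f : R -> R) (x y : R) :
  continuity_pt f x -> continuity_2d_pt (fun u _ => f u) x y.
Proof.
intros H. apply (continuity_1d_2d_pt_comp f (fun u _ => u)); [exact H|].
apply continuity_2d_pt_id1.
Qed.

Lemma continuity_2d_pt_snd (f : R -> R) (x y : R) :
  continuity_pt f y -> continuity_2d_pt (fun _ v => f v) x y.
Proof.
intros H. apply (continuity_1d_2d_pt_comp f (fun _ v => v)); [exact H|].
apply continuity_2d_pt_id2.
Qed.

(** * Angles and polar coordinates *)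

Lemma unit_angle (c s : R) :
  c ^ 2 + s ^ 2 = 1 -> exists t, Rabs t <= PI /\ cos t = c /\ sin t = s.
Proof.
intros H. assert (Hc : -1 <= c <= 1) by nra.
assert (B := acos_bound c).
assert (S : sqrt (1 - c²) = Rabs s).
{ replace (1 - c²) with (s²) by (unfold Rsqr; lra). apply sqrt_Rsqr_abs. }
destruct (Rle_dec 0 s) as [L|L].
- exists (acos c). rewrite (Rabs_pos_eq (acos c)), cos_acos, sin_acos, S by lra.
  rewrite Rabs_pos_eq; lra.
- exists (- acos c).
  rewrite Rabs_Ropp, (Rabs_pos_eq (acos c)), cos_neg, sin_neg, cos_acos, sin_acos, S
    by lra.
  rewrite Rabs_left; lra.
Qed.

Lemma reduce_angle (s : R) :
  exists t, Rabs t <= PI /\ cos t = cos s /\ sin t = sin s.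
Proof. apply unit_angle. rewrite <- !Rsqr_pow2, Rplus_comm. apply sin2_cos2. Qed.

Lemma same_angle (s t : R) :
  cos s = cos t -> sin s = sin t -> exists k : Z, t = s + 2 * IZR k * PI.
Proof.
intros Hc Hs.
assert (C : cos (2 * ((t - s) / 2)) = 1).
{ replace (2 * ((t - s) / 2)) with (t - s) by field.
  rewrite cos_minus, Hc, Hs, Rplus_comm. apply sin2_cos2. }
rewrite cos_2a_sin in C.
destruct (sin_eq_0_0 ((t - s) / 2)) as [k Hk].
{ apply Rsqr_0_uniq. unfold Rsqr. lra. }
exists k. lra.
Qed.

Lemma periodic_Z (f : R -> R) (s : R) (k : Z) :
  (forall s, f (s + 2 * PI) = f s) -> f (s + 2 * IZR k * PI) = f s.
Proof.
intros H.
assert (N : forall (n : nat) s, f (s + 2 * INR n * PI) = f s).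
{ induction n as [|n IH]; intros t.
  - f_equal. simpl. ring.
  - rewrite S_INR, <- (IH t), <- (H (t + 2 * INR n * PI)). f_equal. ring. }
destruct (Z.le_gt_cases 0 k) as [L|L].
- rewrite <- (N (Z.to_nat k) s), INR_IZR_INZ, Z2Nat.id by exact L. reflexivity.
- rewrite <- (N (Z.to_nat (- k)) (s + 2 * IZR k * PI)), INR_IZR_INZ, Z2Nat.id by lia.
  f_equal. rewrite opp_IZR. ring.
Qed.

Lemma sin_cos_turn (s : R) : sin (s + 2 * PI) = sin s /\ cos (s + 2 * PI) = cos s.
Proof. rewrite sin_plus, cos_plus, sin_2PI, cos_2PI. split; ring. Qed.

(** The radial coordinate is the logarithm of the distance to the origin: it
    ranges over the whole line, and differentiation in [r] is the Euler field
    [x * d/dx + y * d/dy] of the star-shapedness condition.  The minus sign in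
    [polar_y] makes the harmonic oscillator turn with speed [1] instead of
    [-1]. *)
Definition polar_x (r s : R) : R := exp r * cos s.
Definition polar_y (r s : R) : R := - (exp r * sin s).

Lemma polar_norm (r s : R) : polar_x r s ^ 2 + polar_y r s ^ 2 = exp r ^ 2.
Proof.
unfold polar_x, polar_y. assert (H := sin2_cos2 s). unfold Rsqr in H.
replace ((exp r * cos s) ^ 2 + (- (exp r * sin s)) ^ 2) with
  (exp r ^ 2 * (sin s * sin s + cos s * cos s)) by ring. rewrite H. ring.
Qed.

Lemma polar_inj (r s r' s' : R) :
  polar_x r s = polar_x r' s' -> polar_y r s = polar_y r' s' ->
  r = r' /\ cos s = cos s' /\ sin s = sin s'.
Proof.
intros Hx Hy.
assert (P := exp_pos r). assert (P' := exp_pos r').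
assert (E : r = r').
{ apply exp_inv, Rsqr_inj; [lra|lra|]. rewrite !Rsqr_pow2.
  rewrite <- (polar_norm r s), Hx, Hy. apply polar_norm. }
subst r'. unfold polar_x, polar_y in Hx, Hy. split; [reflexivity|].
split; apply Rmult_eq_reg_l with (exp r); lra.
Qed.

Lemma polar_exists (x y : R) :
  (x, y) <> (0, 0) -> exists r s, polar_x r s = x /\ polar_y r s = y.
Proof.
intros H. assert (P : 0 < x ^ 2 + y ^ 2).
{ destruct (Req_dec x 0) as [E|E].
  - destruct (Req_dec y 0) as [E'|E']; [subst; now elim H|].
    generalize (pow2_ge_0 x) (pow2_gt_0 y E'). lra.
  - generalize (pow2_ge_0 y) (pow2_gt_0 x E). lra. }
set (d := sqrt (x ^ 2 + y ^ 2)).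
assert (Pd : 0 < d) by now apply sqrt_lt_R0.
assert (Ed : d * d = x ^ 2 + y ^ 2) by (apply sqrt_def; lra).
destruct (unit_angle (x / d) (- y / d)) as [s [_ [Hc Hs]]].
{ replace ((x / d) ^ 2 + (- y / d) ^ 2) with ((x ^ 2 + y ^ 2) / (d * d)) by (field; lra).
  rewrite <- Ed. field. lra. }
exists (ln d), s. unfold polar_x, polar_y. rewrite exp_ln, Hc, Hs by exact Pd.
split; field; lra.
Qed.

Lemma polar_nonzero (r s : R) : (polar_x r s, polar_y r s) <> (0, 0).
Proof.
intros E. injection E as E1 E2. assert (H := polar_norm r s).
rewrite E1, E2 in H. assert (P := pow_lt _ 2 (exp_pos r)). lra.
Qed.

Section Polar.

Variable phi : R -> R -> R.
Hypothesis phi_C1 : is_C1 phi.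

Definition partial_x (x y : R) : R := Derive (fun u => phi u y) x.
Definition partial_y (x y : R) : R := Derive (fun v => phi x v) y.

Definition polar_phi (r s : R) : R := phi (polar_x r s) (polar_y r s).
(** The partial derivatives of [polar_phi], expressed through those of [phi] so
    that star-shapedness speaks directly of [polar_phi_r]. *)
Definition polar_phi_r (r s : R) : R :=
  polar_x r s * partial_x (polar_x r s) (polar_y r s) +
  polar_y r s * partial_y (polar_x r s) (polar_y r s).
Definition polar_phi_s (r s : R) : R :=
  polar_y r s * partial_x (polar_x r s) (polar_y r s) -
  polar_x r s * partial_y (polar_x r s) (polar_y r s).

(** Continuity of the partial derivatives yields differentiability in both
    variables jointly, which the chain rule along a curve requires. *)
Lemma phi_differentiable (x y : R) :
  differentiable_pt_lim phi x y (partial_x x y) (partial_y x y).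
Proof.
apply filterdiff_differentiable_pt_lim.
apply (is_derive_filterdiff phi x y partial_x (partial_y x y)).
- apply filter_forall. intros [u v]. simpl.
  destruct (phi_C1 u v) as [_ [H _]]. now apply Derive_correct.
- destruct (phi_C1 x y) as [_ [_ [H _]]]. now apply Derive_correct.
- destruct (phi_C1 x y) as [_ [_ [_ [[H _] _]]]].
  now apply continuity_2d_pt_filterlim in H.
Qed.

Lemma phi_chain (x y : R -> R) (t x' y' : R) :
  is_derive x t x' -> is_derive y t y' ->
  is_derive (fun t => phi (x t) (y t)) t
    (partial_x (x t) (y t) * x' + partial_y (x t) (y t) * y').
Proof.
rewrite !is_derive_Reals. intros Hx Hy.
apply derivable_pt_lim_comp_2d; auto using phi_differentiable.
Qed.

Lemma polar_derive (r s : R -> R) (t r' s' : R) :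
  is_derive r t r' -> is_derive s t s' ->
  is_derive (fun t => polar_x (r t) (s t)) t
    (polar_x (r t) (s t) * r' + polar_y (r t) (s t) * s') /\
  is_derive (fun t => polar_y (r t) (s t)) t
    (polar_y (r t) (s t) * r' - polar_x (r t) (s t) * s').
Proof.
intros Hr Hs. unfold polar_x, polar_y.
split; auto_derive; try (split; [now exists r'|split; [now exists s'|exact I]]);
change (Derive (fun x => r x) t) with (Derive r t);
change (Derive (fun x => s x) t) with (Derive s t);
rewrite (is_derive_unique r _ _ Hr), (is_derive_unique s _ _ Hs); ring.
Qed.

Lemma psi_chain (r s : R -> R) (t r' s' : R) :
  is_derive r t r' -> is_derive s t s' ->
  is_derive (fun t => polar_phi (r t) (s t)) t
    (polar_phi_r (r t) (s t) * r' + polar_phi_s (r t) (s t) * s').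
Proof.
intros Hr Hs. destruct (polar_derive r s t r' s' Hr Hs) as [Hx Hy].
assert (H := phi_chain _ _ _ _ _ Hx Hy). simpl in H.
unfold polar_phi, polar_phi_r, polar_phi_s. eapply is_derive_ext; [intros u; reflexivity|].
match goal with |- is_derive _ _ ?l =>
  match type of H with is_derive _ _ ?l' => replace l with l' by ring end end.
exact H.
Qed.

Lemma polar_continuity (x y : R) :
  continuity_2d_pt polar_x x y /\ continuity_2d_pt polar_y x y.
Proof.
assert (E : continuity_2d_pt (fun u _ => exp u) x y).
{ apply continuity_2d_pt_fst, derivable_continuous_pt, derivable_pt_exp. }
assert (C : continuity_2d_pt (fun _ v => cos v) x y).
{ apply continuity_2d_pt_snd, continuity_cos. }
assert (S : continuity_2d_pt (fun _ v => sin v) x y).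
{ apply continuity_2d_pt_snd, continuity_sin. }
split.
- now apply continuity_2d_pt_mult.
- now apply continuity_2d_pt_opp, continuity_2d_pt_mult.
Qed.

Lemma partial_continuity (x y : R) :
  continuity_2d_pt phi x y /\ continuity_2d_pt partial_x x y /\
  continuity_2d_pt partial_y x y.
Proof. destruct (phi_C1 x y) as [H [_ [_ [[H1 _] [H2 _]]]]]. auto. Qed.

Lemma psi_continuity (r s : R) :
  continuity_2d_pt polar_phi r s /\ continuity_2d_pt polar_phi_r r s /\
  continuity_2d_pt polar_phi_s r s.
Proof.
destruct (polar_continuity r s) as [Cx Cy].
destruct (partial_continuity (polar_x r s) (polar_y r s)) as [C [Dx Dy]].
assert (K := continuity_2d_pt_comp _ _ _ _ _ C Cx Cy).
assert (Kx := continuity_2d_pt_comp _ _ _ _ _ Dx Cx Cy).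
assert (Ky := continuity_2d_pt_comp _ _ _ _ _ Dy Cx Cy).
split; [exact K|split].
- apply continuity_2d_pt_plus; now apply continuity_2d_pt_mult.
- apply continuity_2d_pt_minus; now apply continuity_2d_pt_mult.
Qed.

(** A function of the point alone that is read in polar coordinates takes all
    its values over angles in [[-PI, PI]]. *)
Lemma psi_bounded (a b : R) :
  exists K, 1 <= K /\ forall r s, a <= r <= b ->
    Rabs (polar_phi r s) <= K /\ Rabs (polar_phi_s r s) <= K.
Proof.
set (M := Rmax PI (Rmax (Rabs a) (Rabs b))).
destruct (bounded_2d polar_phi M) as [K1 H1]; [intros; apply psi_continuity|].
destruct (bounded_2d polar_phi_s M) as [K2 H2]; [intros; apply psi_continuity|].
exists (Rmax 1 (Rmax K1 K2)). split; [apply Rmax_l|]. intros r s Hr.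
destruct (reduce_angle s) as [t [Ht [Ec Es]]].
assert (Mt : Rabs t <= M) by (eapply Rle_trans; [exact Ht|apply Rmax_l]).
assert (Mr : Rabs r <= M).
{ apply Rle_trans with (Rmax (Rabs a) (Rabs b)); [|apply Rmax_r].
  now apply RmaxAbs. }
specialize (H1 r t Mr Mt). specialize (H2 r t Mr Mt).
unfold polar_phi, polar_phi_s, polar_x, polar_y in *. rewrite Ec, Es in H1, H2.
split; (eapply Rle_trans; [eassumption|]).
- eapply Rle_trans; [apply Rmax_l|apply Rmax_r].
- eapply Rle_trans; [apply Rmax_r|apply Rmax_r].
Qed.

End Polar.

(** * The star-shaped cycle *)

Lemma phi_clamped_bl (phi : R -> R -> R) (M : R) :
  is_C1 phi -> 0 <= M ->
  bdd_lipschitz (fun x y => phi (clamp (- M) M x) (clamp (- M) M y)).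
Proof.
intros HC HM.
destruct (bounded_2d phi M) as [B HB]; [intros; now apply partial_continuity|].
destruct (bounded_2d (partial_x phi) M) as [K1 H1]; [intros; now apply partial_continuity|].
destruct (bounded_2d (partial_y phi) M) as [K2 H2]; [intros; now apply partial_continuity|].
assert (C : forall z, - M <= clamp (- M) M z <= M) by (intros; apply clamp_bound; lra).
assert (CB : forall z, Rabs (clamp (- M) M z) <= M) by (intros; now apply Rabs_le).
apply (bl_intro _ B (Rmax K1 K2)).
- intros x y. now apply HB.
- intros x y x' y'.
  assert (L1 := clamp_lipschitz (- M) M x x').
  assert (L2 := clamp_lipschitz (- M) M y y').
  assert (C1 := C x). assert (C1' := C x'). assert (C2 := C y). assert (C2' := C y').
  assert (b1 := CB y). assert (b2 := CB x').
  revert L1 L2 C1 C1' C2 C2' b1 b2.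
  generalize (clamp (- M) M x), (clamp (- M) M x'), (clamp (- M) M y), (clamp (- M) M y').
  intros u u' v v' L1 L2 C1 C1' C2 C2' b1 b2.
  destruct (mean_value (fun z => phi z v) (fun z => partial_x phi z v) u' u)
    as [c [Hc Ec]].
  { intros t _. destruct (HC t v) as [_ [H _]]. now apply Derive_correct. }
  destruct (mean_value (fun z => phi u' z) (fun z => partial_y phi u' z) v' v)
    as [d [Hd Ed]].
  { intros t _. destruct (HC u' t) as [_ [_ [H _]]]. now apply Derive_correct. }
  assert (M1 : - M <= Rmin u' u) by (apply Rmin_glb; lra).
  assert (M2 : Rmax u' u <= M) by (apply Rmax_lub; lra).
  assert (M3 : - M <= Rmin v' v) by (apply Rmin_glb; lra).
  assert (M4 : Rmax v' v <= M) by (apply Rmax_lub; lra).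
  assert (X1 : Rabs (partial_x phi c v) <= K1) by (apply H1; [apply Rabs_le; lra|lra]).
  assert (X2 : Rabs (partial_y phi u' d) <= K2) by (apply H2; [lra|apply Rabs_le; lra]).
  replace (phi u v - phi u' v') with
    ((phi u v - phi u' v) + (phi u' v - phi u' v')) by ring.
  eapply Rle_trans; [apply Rabs_triang|]. rewrite Ec, Ed, !Rabs_mult.
  rewrite Rmult_plus_distr_l.
  apply Rplus_le_compat; (apply Rmult_le_compat; [apply Rabs_pos|apply Rabs_pos| |lra]).
  + eapply Rle_trans; [exact X1|apply Rmax_l].
  + eapply Rle_trans; [exact X2|apply Rmax_r].
Qed.

Lemma psi_clamped_bl (phi : R -> R -> R) (a b : R) :
  is_C1 phi -> a <= b -> bdd_lipschitz (fun r s => polar_phi phi (clamp a b r) s).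
Proof.
intros HC Hab.
assert (HE : bdd_lipschitz (fun r _ => exp (clamp a b r))).
{ apply (bl_clamped exp exp a b (exp b)); [exact Hab|]. intros t Ht. split.
  - apply is_derive_Reals, derivable_pt_lim_exp.
  - rewrite Rabs_pos_eq by (left; apply exp_pos). now apply exp_nondecreasing. }
assert (HX := bl_mult _ _ HE bl_cos).
assert (HY := bl_opp _ (bl_mult _ _ HE bl_sin)).
assert (P := exp_pos b).
assert (H := bl_comp _ _ _ (phi_clamped_bl phi (exp b) HC ltac:(lra)) HX HY).
revert H. apply bl_ext. intros r s.
assert (Q := clamp_bound a b r Hab). unfold polar_phi, polar_x, polar_y.
revert Q. generalize (clamp a b r). intros q Q.
assert (Pq := exp_pos q). assert (Eq : exp q <= exp b) by (apply exp_nondecreasing; lra).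
assert (Hs := SIN_bound s). assert (Hc := COS_bound s).
rewrite !clamp_id; [reflexivity|nra|nra].
Qed.

(** Without truncation the derivative of the quotient in [p] is
    [1 / (1 - k * p) ^ 2].  The truncation [e < 1] preserves monotonicity since
    [1 - k * p < e] forces [k] and [p] to have the same sign. *)
Lemma quotient_incr (k e p p' : R) :
  0 < e < 1 -> p <= p' ->
  p * / Rmax (1 - k * p) e <= p' * / Rmax (1 - k * p') e.
Proof.
intros He Hp.
assert (X : forall u, e <= Rmax (1 - k * u) e) by (intros; apply Rmax_r).
assert (Q : p * Rmax (1 - k * p') e <= p' * Rmax (1 - k * p) e).
{ destruct (Req_dec p p') as [<-|Hn]; [lra|].
  destruct (Rle_dec (1 - k * p) e) as [A|A];
  destruct (Rle_dec (1 - k * p') e) as [A'|A'].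
  - rewrite !Rmax_right by assumption. nra.
  - rewrite Rmax_left, Rmax_right by lra. apply Rnot_le_lt in A'.
    assert (k <= 0) by nra. destruct (Rle_dec p 0); nra.
  - rewrite Rmax_right, Rmax_left by lra. apply Rnot_le_lt in A.
    assert (0 <= k) by nra. destruct (Rle_dec 0 p'); nra.
  - rewrite !Rmax_left by lra. nra. }
assert (X1 := X p). assert (X2 := X p').
apply Rmult_le_reg_r with (Rmax (1 - k * p) e); [lra|].
apply Rmult_le_reg_r with (Rmax (1 - k * p') e); [lra|].
rewrite Rmult_assoc, (Rmult_assoc p'). field_simplify; lra.
Qed.

Section StarShaped.

Variable phi : R -> R -> R.
Hypothesis phi_C1 : is_C1 phi.
Hypothesis phi_star : strictly_star_shaped phi.
Variables a b : R.
Hypothesis psi_neg : forall r s, r <= a -> polar_phi phi r s < 0.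
Hypothesis psi_nonneg : forall r s, b <= r -> 0 <= polar_phi phi r s.

Notation psi := (polar_phi phi).
Notation psi_r := (polar_phi_r phi).
Notation psi_s := (polar_phi_s phi).

Lemma negative_radius_lt_nonneg : a < b.
Proof.
apply Rnot_le_lt. intros H.
generalize (psi_neg a 0 (Rle_refl _)) (psi_nonneg a 0 H). lra.
Qed.

Lemma psi_derive_r (r s : R) : is_derive (fun u => psi u s) r (psi_r r s).
Proof.
assert (H := psi_chain phi phi_C1 (fun u => u) (fun _ => s) r 1 0
  (is_derive_id r) (is_derive_const s r)). simpl in H.
rewrite Rmult_1_r, Rmult_0_r, Rplus_0_r in H. exact H.
Qed.

(** On a ray the radial derivative has constant sign by the intermediate value
    theorem, and [psi] goes from a negative to a nonnegative value. *)
Lemma psi_r_pos (r s : R) : 0 < psi_r r s.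
Proof.
assert (nz : forall u, psi_r u s <> 0).
{ intros u. apply (phi_star _ _ (polar_nonzero u s)). }
destruct (Rlt_le_dec 0 (psi_r r s)) as [H|H]; [exact H|exfalso].
assert (H' : psi_r r s < 0) by (generalize (nz r); lra). clear H.
assert (neg : forall u, psi_r u s <= 0).
{ intros u. apply Rnot_lt_le. intros Hu.
  destruct (IVT_gen (fun u => psi_r u s) r u 0) as [z [_ Hz]].
  - intros z. apply continuity_2d_pt_slice. now apply psi_continuity.
  - rewrite Rmin_left, Rmax_right; lra.
  - now apply (nz z). }
assert (D := nonincreasing_of_derive (fun u => psi u s) (fun u => psi_r u s) a b
  (Rlt_le _ _ negative_radius_lt_nonneg) (fun t _ => psi_derive_r t s) (fun t _ => neg t)).
generalize (psi_neg a s (Rle_refl _)) (psi_nonneg b s (Rle_refl _)). simpl in D. lra.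
Qed.

(** Over a compact annulus the radial derivative has a positive minimum. *)
Lemma psi_strong_monotone (c d : R) :
  exists m, 0 < m /\
    (forall r s, c <= r <= d -> m <= psi_r r s) /\
    forall r r' s, c <= r <= d -> c <= r' <= d ->
      m * (r - r') ^ 2 <= (r - r') * (psi r s - psi r' s).
Proof.
set (M := Rmax PI (Rmax (Rabs c) (Rabs d))).
destruct (positive_2d psi_r M) as [m [Hm H]];
  [intros; now apply psi_continuity|exact psi_r_pos|].
assert (L : forall r s, c <= r <= d -> m <= psi_r r s).
{ intros r s Hr. destruct (reduce_angle s) as [t [Ht [Ec Es]]].
  assert (X : m <= psi_r r t).
  { apply H.
    - apply Rle_trans with (Rmax (Rabs c) (Rabs d)); [now apply RmaxAbs|apply Rmax_r].
    - eapply Rle_trans; [exact Ht|apply Rmax_l]. }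
  unfold polar_phi_r, polar_x, polar_y in *. rewrite Ec, Es in X. exact X. }
exists m. split; [exact Hm|split; [exact L|]].
intros r r' s Hr Hr'.
destruct (mean_value (fun u => psi u s) (fun u => psi_r u s) r' r) as [z [Hz E]].
{ intros; apply psi_derive_r. }
simpl in E. rewrite E.
assert (M1 : c <= Rmin r' r) by (apply Rmin_glb; lra).
assert (M2 : Rmax r' r <= d) by (apply Rmax_lub; lra).
assert (X := L z s ltac:(lra)). generalize (pow2_ge_0 (r - r')). nra.
Qed.

Lemma psi_incr (r r' s : R) : r <= r' -> psi r s <= psi r' s.
Proof.
intros H. destruct (psi_strong_monotone r r') as [m [Hm [_ X]]].
specialize (X r' r s ltac:(lra) ltac:(lra)).
destruct H as [H| <-]; [|lra].
assert (P := Rmult_le_pos _ _ (Rlt_le _ _ Hm) (pow2_ge_0 (r' - r))).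
enough (0 <= psi r' s - psi r s) by lra.
apply Rmult_le_reg_l with (r' - r); lra.
Qed.

Section Truncated.

Variable e : R.
Hypothesis e_range : 0 < e < 1.

(** The slope [dr/ds] along orbits, modified only outside the annulus [[a, b]]
    and where the angular speed is less than [e].  The modification provides a
    bounded Lipschitz field while keeping it monotone in [r]. *)
Definition slope (r s : R) : R :=
  - (sin s ^ 2 * (psi (clamp a b r) s *
     / Rmax (1 - sin s * cos s * psi (clamp a b r) s) e)).

Lemma slope_bl : bdd_lipschitz slope.
Proof.
assert (P := psi_clamped_bl phi a b phi_C1 (Rlt_le _ _ negative_radius_lt_nonneg)).
apply bl_opp, bl_mult.
- apply (bl_ext (fun _ s => sin s * sin s)); [intros; ring|].
  exact (bl_mult _ _ bl_sin bl_sin).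
- apply bl_mult; [exact P|]. apply bl_inv_max; [apply e_range|].
  apply bl_minus; [apply bl_const|].
  exact (bl_mult _ _ (bl_mult _ _ bl_sin bl_cos) P).
Qed.

Lemma slope_decr (r r' s : R) : r <= r' -> slope r' s <= slope r s.
Proof.
intros H. apply Ropp_le_contravar. apply Rmult_le_compat_l; [apply pow2_ge_0|].
apply quotient_incr; [exact e_range|]. now apply psi_incr, clamp_incr.
Qed.

Lemma slope_periodic (r s : R) : slope r (s + 2 * PI) = slope r s.
Proof.
unfold slope, polar_phi, polar_x, polar_y. destruct (sin_cos_turn s) as [-> ->]. reflexivity.
Qed.

Lemma slope_sign (r s : R) :
  (r < a -> 0 <= slope r s) /\ (b < r -> slope r s <= 0).
Proof.
assert (Hab := negative_radius_lt_nonneg). unfold slope.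
assert (X := Rmax_r (1 - sin s * cos s * psi (clamp a b r) s) e).
assert (I : 0 < / Rmax (1 - sin s * cos s * psi (clamp a b r) s) e)
  by (apply Rinv_0_lt_compat; lra).
assert (S := pow2_ge_0 (sin s)).
assert (J := Rmult_le_pos _ _ S (Rlt_le _ _ I)).
split; intros Hr.
- assert (psi (clamp a b r) s < 0).
  { apply psi_neg. unfold clamp. apply Rmax_lub; [lra|].
    eapply Rle_trans; [apply Rmin_r|lra]. }
  nra.
- assert (0 <= psi (clamp a b r) s).
  { apply psi_nonneg. unfold clamp. rewrite Rmin_left by lra. apply Rmax_r. }
  nra.
Qed.

Lemma slope_flow (u : R) :
  exists rho, rho 0 = u /\ forall s, is_derive rho s (slope (rho s) s).
Proof.
destruct (picard slope (fun _ _ => 1) u 0 slope_bl (bl_const 1))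
  as [x [y [Ex [Ey H]]]].
assert (Y : forall t, y t = t).
{ intros t. destruct (mean_value y (fun _ => 1) 0 t) as [c [_ E]]; [intros; apply H|].
  lra. }
exists x. split; [exact Ex|]. intros s. destruct (H s) as [D _]. now rewrite Y in D.
Qed.

(** A slope that decreases with [r] brings solutions closer together. *)
Lemma slope_contracts (rho rho' : R -> R) (T : R) :
  0 <= T ->
  (forall s, is_derive rho s (slope (rho s) s)) ->
  (forall s, is_derive rho' s (slope (rho' s) s)) ->
  Rabs (rho T - rho' T) <= Rabs (rho 0 - rho' 0).
Proof.
intros HT H H'. apply Rsqr_le_abs_0. rewrite !Rsqr_pow2.
apply (nonincreasing_of_derive (fun t => (rho t - rho' t) ^ 2)
  (fun t => 2 * (rho t - rho' t) * (slope (rho t) t - slope (rho' t) t))); [exact HT| |].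
- intros t _. auto_derive; [split; [eexists; apply H|split; [eexists; apply H'|exact I]]|].
  change (Derive (fun x => rho x) t) with (Derive rho t).
  change (Derive (fun x => rho' x) t) with (Derive rho' t).
  rewrite (is_derive_unique rho _ _ (H t)), (is_derive_unique rho' _ _ (H' t)). ring.
- intros t _. destruct (Rle_dec (rho t) (rho' t)) as [L|L].
  + generalize (slope_decr _ _ t L). nra.
  + generalize (slope_decr (rho' t) (rho t) t ltac:(lra)). nra.
Qed.

Lemma slope_invariant (rho : R -> R) (T : R) :
  0 <= T -> (forall s, is_derive rho s (slope (rho s) s)) ->
  a <= rho 0 <= b -> a <= rho T <= b.
Proof.
intros HT H H0. split.
- apply (barrier rho (fun t => slope (rho t) t)); auto; [lra|].
  intros t _. apply slope_sign.
- enough (- b <= - rho T) by lra.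
  apply (barrier (fun t => - rho t) (fun t => - slope (rho t) t)); auto; [|lra|].
  + intros t _. now apply (is_derive_opp rho).
  + intros t _ Ht. assert (b < rho t) by lra. generalize (proj2 (slope_sign (rho t) t)). lra.
Qed.

(** The map [rho 0 |-> rho (2 * PI)] is continuous and preserves [[a, b]]; the
    intermediate value theorem provides a fixed point. *)
Lemma slope_periodic_solution :
  exists rho : R -> R,
    (forall s, is_derive rho s (slope (rho s) s)) /\
    (forall s, rho (s + 2 * PI) = rho s) /\ (forall s, a <= rho s <= b).
Proof.
assert (Hab := negative_radius_lt_nonneg). assert (Hpi := PI2_1).
destruct (functional_choice (fun u (f : R -> R) =>
   f 0 = u /\ forall s, is_derive f s (slope (f s) s)) slope_flow) as [F HF].
destruct (IVT_gen (fun u => F u (2 * PI) - u) a b 0) as [u [Hu Fu]].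
{ apply continuity_minus; [|apply derivable_continuous, derivable_id].
  intros u. apply continuity_pt_locally. intros eps. exists eps. intros v Hv.
  eapply Rle_lt_trans; [apply slope_contracts; [lra|apply HF|apply HF]|].
  rewrite !(proj1 (HF _)). exact Hv. }
{ destruct (HF a) as [A1 A2]. destruct (HF b) as [B1 B2].
  assert (A := slope_invariant (F a) (2 * PI) ltac:(lra) A2 ltac:(lra)).
  assert (B := slope_invariant (F b) (2 * PI) ltac:(lra) B2 ltac:(lra)).
  rewrite Rmin_right, Rmax_left by lra. lra. }
rewrite Rmin_left, Rmax_right in Hu by lra.
destruct (HF u) as [rho0 HR]. exists (F u). revert rho0 HR Fu. generalize (F u).
intros rho rho0 HR Fu.
assert (Per : forall s, rho (s + 2 * PI) = rho s).
{ intros s.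
  destruct (ode_unique slope (fun _ _ => 1) (fun t => rho (t + 2 * PI)) (fun t => t)
    rho (fun t => t) 0 s slope_bl (bl_const 1)) as [E _].
  - intros t _. split; [|apply @is_derive_id].
    rewrite <- slope_periodic. auto_derive; [eexists; apply HR|].
    change (Derive (fun x => rho x) (t + 2 * PI)) with (Derive rho (t + 2 * PI)).
    rewrite (is_derive_unique rho _ _ (HR _)). ring.
  - intros t _. split; [apply HR|apply @is_derive_id].
  - rewrite Rplus_0_l. lra.
  - reflexivity.
  - exact E. }
split; [exact HR|split; [exact Per|]].
intros s. rewrite <- (periodic_Z rho s (up (Rabs s)) Per).
apply slope_invariant; [|exact HR|lra].
destruct (archimed (Rabs s)) as [A _].
generalize (Rle_abs (- s)) (Rabs_pos s). rewrite Rabs_Ropp. nra.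
Qed.

End Truncated.

Definition angular_speed (rho : R -> R) (s : R) : R := 1 - sin s * cos s * psi (rho s) s.

(** This describes the closed curve [r = rho s] as an orbit: the flow traverses
    it with angular speed at least [e], and the last clause is the quotient of
    the equations for [r'] and [s']. *)
Definition star_cycle (rho : R -> R) (e : R) : Prop :=
  0 < e /\ (forall s, rho (s + 2 * PI) = rho s) /\ (forall s, a <= rho s <= b) /\
  (forall s, e <= angular_speed rho s) /\
  forall s, is_derive rho s (- (sin s ^ 2 * psi (rho s) s) / angular_speed rho s).

(** Where the angular speed [beta] of a solution of the truncated equation is
    below [e <= 1/2], the product [sin s * cos s * psi] exceeds [1/2], so that
    [sin s ^ 2 >= 1 / (4 * K ^ 2)] with [K] a bound of [psi] and [psi_s].  The
    radial term of [beta'] is then at least [m / (8 * K ^ 2 * e)], where [m] is a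
    lower bound of [psi_r], whereas the others are at least [- 2 * K].  With
    [e <= m / (24 * K ^ 3)] the sum is positive, so [beta] cannot cross [e]
    downwards, and [beta 0 = 1]. *)
Lemma star_cycle_exists : exists rho e, star_cycle rho e.
Proof.
assert (Hab := negative_radius_lt_nonneg).
destruct (psi_bounded phi phi_C1 a b) as [K [K1 HK]].
destruct (psi_strong_monotone a b) as [m [Hm [Hmr _]]].
assert (K3 : 0 < K ^ 3) by (apply pow_lt; lra).
set (e := Rmin (/ 2) (m / (24 * K ^ 3))).
assert (e1 : e <= / 2) by apply Rmin_l.
assert (e2 : e <= m / (24 * K ^ 3)) by apply Rmin_r.
assert (e0 : 0 < e).
{ apply Rmin_glb_lt; [lra|]. apply Rdiv_lt_0_compat; lra. }
destruct (slope_periodic_solution e ltac:(lra)) as [rho [HR [Per HRab]]].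
assert (Es : forall s, slope e (rho s) s =
   - (sin s ^ 2 * (psi (rho s) s * / Rmax (angular_speed rho s) e))).
{ intros s. unfold slope, angular_speed. now rewrite clamp_id. }
assert (D : forall s, is_derive (angular_speed rho) s
  (- (cos s ^ 2 - sin s ^ 2) * psi (rho s) s -
   sin s * cos s * (psi_r (rho s) s * slope e (rho s) s + psi_s (rho s) s))).
{ intros s. assert (C := psi_chain phi phi_C1 rho (fun s => s) s _ 1 (HR s)
    (is_derive_id s)). simpl in C.
  assert (gen : forall (q : R -> R) q', is_derive q s q' ->
    is_derive (fun t => 1 - sin t * cos t * q t) s
      (- (cos s ^ 2 - sin s ^ 2) * q s - sin s * cos s * q')).
  { intros q q' Hq. auto_derive; [now exists q'|].
    change (Derive (fun x => q x) s) with (Derive q s).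
    rewrite (is_derive_unique q _ _ Hq). ring. }
  rewrite Rmult_1_r in C. exact (gen _ _ C). }
assert (low0 : forall s, 0 <= s -> e <= angular_speed rho s).
{ intros s Hs.
  apply (barrier (angular_speed rho) _ e s Hs (fun t _ => D t)).
  - unfold angular_speed. rewrite sin_0. lra.
  - intros t _ Ht. rewrite Es, Rmax_right by lra.
    destruct (HK (rho t) t (HRab t)) as [B1 B2].
    assert (B3 := Hmr (rho t) t (HRab t)).
    unfold angular_speed in Ht. revert Ht B1 B2 B3.
    generalize (psi (rho t) t), (psi_s (rho t) t), (psi_r (rho t) t).
    intros p q g Ht B1 B2 B3.
    assert (SC := sin2_cos2 t). unfold Rsqr in SC. revert Ht SC.
    generalize (sin t), (cos t). intros s0 c Ht SC.
    assert (H12 : / 2 <= s0 * c * p) by lra.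
    apply Rabs_le_between in B1. apply Rabs_le_between in B2.
    assert (sc : - 1 <= s0 * c <= 1) by nra.
    assert (scq : - K <= s0 * c * q <= K) by nra.
    assert (cc : - K <= (c ^ 2 - s0 ^ 2) * p <= K) by nra.
    assert (s2 : / (4 * K ^ 2) <= s0 ^ 2).
    { assert (Q : 1 <= 4 * K ^ 2 * s0 ^ 2).
      { assert (p ^ 2 <= K ^ 2) by nra. assert (c ^ 2 <= 1) by nra.
        assert (/ 4 <= (s0 * c * p) ^ 2) by nra.
        assert (c ^ 2 * p ^ 2 <= K ^ 2) by nra.
        assert (S := pow2_ge_0 s0). nra. }
      apply Rmult_le_reg_l with (4 * K ^ 2); [nra|].
      rewrite Rinv_r by nra. exact Q. }
    assert (ie : 24 * K ^ 3 / m <= / e).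
    { replace (24 * K ^ 3 / m) with (/ (m / (24 * K ^ 3))) by (field; split; nra).
      now apply Rinv_le_contravar. }
    assert (big : 3 * K <= (s0 * c * p) * (s0 ^ 2 * (g * / e))).
    { apply Rle_trans with (/ 2 * (/ (4 * K ^ 2) * (m * (24 * K ^ 3 / m)))).
      - right. field. split; nra.
      - assert (0 < / (4 * K ^ 2)) by (apply Rinv_0_lt_compat; nra).
        assert (0 < 24 * K ^ 3 / m) by (apply Rdiv_lt_0_compat; lra).
        apply Rmult_le_compat; [lra| |exact H12|].
        + apply Rmult_le_pos; [lra|]. apply Rmult_le_pos; lra.
        + apply Rmult_le_compat; [lra| |exact s2|].
          * apply Rmult_le_pos; lra.
          * apply Rmult_le_compat; lra. }
    replace (- (c ^ 2 - s0 ^ 2) * p - s0 * c * (g * - (s0 ^ 2 * (p * / e)) + q)) with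
      (- ((c ^ 2 - s0 ^ 2) * p) - s0 * c * q + (s0 * c * p) * (s0 ^ 2 * (g * / e))) by ring.
    lra. }
assert (low : forall s, e <= angular_speed rho s).
{ intros s. assert (PA : forall s, angular_speed rho (s + 2 * PI) = angular_speed rho s).
  { intros t. unfold angular_speed, polar_phi, polar_x, polar_y.
    destruct (sin_cos_turn t) as [-> ->]. now rewrite Per. }
  rewrite <- (periodic_Z _ s (up (Rabs s)) PA). apply low0.
  destruct (archimed (Rabs s)) as [A _]. assert (Hpi := PI2_1).
  generalize (Rle_abs (- s)) (Rabs_pos s). rewrite Rabs_Ropp. nra. }
exists rho, e. repeat (split; [assumption|]). intros s.
assert (X := HR s). rewrite Es, Rmax_left in X by apply low.
replace (- (sin s ^ 2 * psi (rho s) s) / angular_speed rho s) with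
  (- (sin s ^ 2 * (psi (rho s) s * / angular_speed rho s))); [exact X|].
field. generalize (low s). lra.
Qed.

End StarShaped.

(** * Orbits in polar coordinates and their continuation *)

Section Orbits.

Variable phi : R -> R -> R.
Hypothesis phi_C1 : is_C1 phi.

Notation psi := (polar_phi phi).

Lemma orbit_through_origin (A B : Rbar) (g : R -> R * R) (t0 : R) :
  solution_on (planar_field phi) A B g -> in_oint A B t0 -> g t0 = (0, 0) ->
  forall t, in_oint A B t -> g t = (0, 0).
Proof.
intros Hg H0 E0 t Ht.
set (x := fun t => fst (g t)). set (y := fun t => snd (g t)).
assert (between : forall u, Rmin t0 t <= u <= Rmax t0 t -> in_oint A B u)
  by (intros; now apply (in_oint_between A B t0 t)).
assert (Dx : forall u, Rmin t0 t <= u <= Rmax t0 t -> is_derive x u (y u)).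
{ intros u Hu. apply Hg, between, Hu. }
assert (Dy : forall u, Rmin t0 t <= u <= Rmax t0 t ->
   is_derive y u (- x u - y u * phi (x u) (y u))).
{ intros u Hu. apply Hg, between, Hu. }
destruct (continuity_ab_maj (fun u => Rabs (phi (x u) (y u))) (Rmin t0 t) (Rmax t0 t))
  as [m [Hm _]].
{ apply Rminmax. }
{ intros u Hu. apply (continuity_pt_comp (fun u => phi (x u) (y u)) Rabs).
  - exact (is_derive_continuity_pt _ _ _
      (phi_chain phi phi_C1 x y u _ _ (Dx u Hu) (Dy u Hu))).
  - apply Rcontinuity_abs. }
set (K := Rabs (phi (x m) (y m))) in Hm.
assert (Z : x t ^ 2 + y t ^ 2 = 0).
{ apply (gronwall_zero (fun u => x u ^ 2 + y u ^ 2)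
    (fun u => - (2 * y u ^ 2 * phi (x u) (y u))) (2 * K) t0 t).
  - intros u Hu. assert (X := Dx u Hu). assert (Y := Dy u Hu).
    specialize (Hm u Hu). simpl in Hm. fold K in Hm. split; [|split].
    + auto_derive; [split; [eexists; exact X|split; [eexists; exact Y|exact I]]|].
      change (Derive (fun z => x z) u) with (Derive x u).
      change (Derive (fun z => y z) u) with (Derive y u).
      rewrite (is_derive_unique x _ _ X), (is_derive_unique y _ _ Y). ring.
    + apply Rplus_le_le_0_compat; apply pow2_ge_0.
    + rewrite Rabs_Ropp, Rabs_mult, (Rabs_pos_eq (2 * y u ^ 2))
        by (generalize (pow2_ge_0 (y u)); lra).
      assert (P := pow2_ge_0 (x u)). assert (Q := pow2_ge_0 (y u)).
      assert (K0 : 0 <= K) by apply Rabs_pos. nra.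
  - unfold x, y. rewrite E0. simpl. ring. }
assert (P := pow2_ge_0 (x t)). assert (Q := pow2_ge_0 (y t)).
rewrite (surjective_pairing (g t)). fold (x t) (y t).
f_equal; apply Rsqr_0_uniq; rewrite Rsqr_pow2; lra.
Qed.

(** The differential equations are part of the definition, so that what follows
    need not return to cartesian coordinates. *)
Definition polar_lift (g : R -> R * R) (r s : R -> R) (t : R) : Prop :=
  g t = (polar_x (r t) (s t), polar_y (r t) (s t)) /\
  is_derive r t (- (sin (s t) ^ 2 * psi (r t) (s t))) /\
  is_derive s t (1 - sin (s t) * cos (s t) * psi (r t) (s t)).

(** The coordinates are obtained by integrating the radial and angular
    velocities, which are known functions of time along [g]; no continuous choice
    of an angle is required.  That the origin is avoided follows from
    uniqueness. *)
Lemma polar_lift_exists (A B : Rbar) (g : R -> R * R) :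
  solution_on (planar_field phi) A B g -> non_constant_on A B g ->
  exists r s, forall t, in_oint A B t -> polar_lift g r s t.
Proof.
intros Hg [t0 [t1 [I0 [I1 Hne]]]].
set (x := fun t => fst (g t)). set (y := fun t => snd (g t)).
assert (Eg : forall t, g t = (x t, y t)) by (intros; apply surjective_pairing).
assert (nz : forall t, in_oint A B t -> 0 < x t ^ 2 + y t ^ 2).
{ intros t Ht. assert (P := pow2_ge_0 (x t)). assert (Q := pow2_ge_0 (y t)).
  destruct (Rle_lt_or_eq_dec 0 (x t ^ 2 + y t ^ 2)) as [H|H]; [lra|exact H|exfalso].
  assert (E : g t = (0, 0)).
  { rewrite Eg. f_equal; apply Rsqr_0_uniq; rewrite Rsqr_pow2; lra. }
  apply Hne. rewrite !(orbit_through_origin A B g t); auto. }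
assert (Dx : forall t, in_oint A B t -> is_derive x t (y t)).
{ intros t Ht. now apply Hg. }
assert (Dy : forall t, in_oint A B t -> is_derive y t (- x t - y t * phi (x t) (y t))).
{ intros t Ht. now apply Hg. }
set (k := fun t => - (y t ^ 2 * phi (x t) (y t)) / (x t ^ 2 + y t ^ 2)).
set (w := fun t => 1 + x t * y t * phi (x t) (y t) / (x t ^ 2 + y t ^ 2)).
assert (Ckw : forall t, in_oint A B t -> continuous k t /\ continuous w t).
{ intros t Ht. assert (X := Dx t Ht). assert (Y := Dy t Ht).
  assert (F := phi_chain phi phi_C1 x y t _ _ X Y).
  assert (gen : forall f : R -> R, ex_derive f t ->
     ex_derive (fun t => - (y t ^ 2 * f t) / (x t ^ 2 + y t ^ 2)) t /\
     ex_derive (fun t => 1 + x t * y t * f t / (x t ^ 2 + y t ^ 2)) t).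
  { intros f Hf. specialize (nz t Ht). split; auto_derive;
      repeat split; try (eexists; eassumption); try assumption; lra. }
  destruct (gen (fun t => phi (x t) (y t))) as [G1 G2]; [eexists; exact F|].
  split; now apply (ex_derive_continuous (K := R_AbsRing) (V := R_NormedModule)). }
destruct (polar_exists (x t0) (y t0)) as [r0 [s0 [Hx0 Hy0]]].
{ intros E. injection E as E1 E2. generalize (nz t0 I0). rewrite E1, E2. lra. }
set (r := fun t => r0 + RInt k t0 t). set (s := fun t => s0 + RInt w t0 t).
assert (Dr : forall t, in_oint A B t -> is_derive r t (k t)).
{ apply is_derive_RInt_oint; [exact I0|apply Ckw]. }
assert (Ds : forall t, in_oint A B t -> is_derive s t (w t)).
{ apply is_derive_RInt_oint; [exact I0|apply Ckw]. }
(* Both sides solve the linear system [z' = (k - i * w) * z], whose solutions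
   have a norm proportional to [exp r]. *)
assert (P : forall t, in_oint A B t ->
  x t = polar_x (r t) (s t) /\ y t = polar_y (r t) (s t)).
{ intros t Ht.
  set (u := fun t => x t - polar_x (r t) (s t)).
  set (v := fun t => y t - polar_y (r t) (s t)).
  assert (Du : forall t, in_oint A B t -> is_derive u t (u t * k t + v t * w t)).
  { intros z Hz. unfold u, v.
    replace ((x z - polar_x (r z) (s z)) * k z + (y z - polar_y (r z) (s z)) * w z)
      with (y z - (polar_x (r z) (s z) * k z + polar_y (r z) (s z) * w z)).
    - apply (is_derive_minus x (fun t => polar_x (r t) (s t))); [now apply Dx|].
      apply polar_derive; auto.
    - unfold k, w. generalize (nz z Hz). intros. field. lra. }
  assert (Dv : forall t, in_oint A B t -> is_derive v t (v t * k t - u t * w t)).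
  { intros z Hz. unfold u, v.
    replace ((y z - polar_y (r z) (s z)) * k z - (x z - polar_x (r z) (s z)) * w z)
      with ((- x z - y z * phi (x z) (y z)) -
            (polar_y (r z) (s z) * k z - polar_x (r z) (s z) * w z)).
    - apply (is_derive_minus y (fun t => polar_y (r t) (s t))); [now apply Dy|].
      apply polar_derive; auto.
    - unfold k, w. generalize (nz z Hz). intros. field. lra. }
  assert (Z : (u t ^ 2 + v t ^ 2) * exp (- 2 * r t) =
              (u t0 ^ 2 + v t0 ^ 2) * exp (- 2 * r t0)).
  { apply (derive_zero_const (fun t => (u t ^ 2 + v t ^ 2) * exp (- 2 * r t))).
    intros z Hz. assert (Iz := in_oint_between A B t0 t z I0 Ht Hz).
    assert (X := Du z Iz). assert (Y := Dv z Iz). assert (Q := Dr z Iz).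
    auto_derive.
    - repeat split; eexists; eassumption.
    - change (Derive (fun z => u z) z) with (Derive u z).
      change (Derive (fun z => v z) z) with (Derive v z).
      change (Derive (fun z => r z) z) with (Derive r z).
      rewrite (is_derive_unique u _ _ X), (is_derive_unique v _ _ Y),
        (is_derive_unique r _ _ Q). ring. }
  assert (r t0 = r0 /\ s t0 = s0) as [Er Es].
  { unfold r, s. rewrite !RInt_point. split; apply Rplus_0_r. }
  assert (u t0 = 0) as Eu by (unfold u; rewrite Er, Es; lra).
  assert (v t0 = 0) as Ev by (unfold v; rewrite Er, Es; lra).
  rewrite Eu, Ev in Z. assert (Q := exp_pos (- 2 * r t)).
  assert (Z' : u t ^ 2 + v t ^ 2 = 0).
  { apply Rmult_eq_reg_r with (exp (- 2 * r t)); [|lra]. rewrite Z. ring. }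
  assert (P1 := pow2_ge_0 (u t)). assert (P2 := pow2_ge_0 (v t)).
  split; apply Rminus_diag_uniq, Rsqr_0_uniq; rewrite Rsqr_pow2;
    fold (u t) (v t); lra. }
exists r, s. intros t Ht. destruct (P t Ht) as [Px Py].
assert (Nz := nz t Ht).
split; [now rewrite Eg, Px, Py|].
assert (X := Dr t Ht). assert (Y := Ds t Ht). unfold k, w in X, Y.
rewrite Px, Py, polar_norm in X, Y. fold (psi (r t) (s t)) in X, Y.
unfold polar_x, polar_y in X, Y. assert (Q := exp_pos (r t)).
split.
- replace (- (sin (s t) ^ 2 * psi (r t) (s t))) with
    (- ((- (exp (r t) * sin (s t))) ^ 2 * psi (r t) (s t)) / exp (r t) ^ 2)
    by (field; lra). exact X.
- replace (1 - sin (s t) * cos (s t) * psi (r t) (s t)) with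
    (1 + exp (r t) * cos (s t) * - (exp (r t) * sin (s t)) * psi (r t) (s t) /
      exp (r t) ^ 2) by (field; lra). exact Y.
Qed.

Lemma polar_lift_solution (r s : R -> R) (t : R) :
  is_derive r t (- (sin (s t) ^ 2 * psi (r t) (s t))) ->
  is_derive s t (1 - sin (s t) * cos (s t) * psi (r t) (s t)) ->
  is_derive (fun t => polar_x (r t) (s t)) t (polar_y (r t) (s t)) /\
  is_derive (fun t => polar_y (r t) (s t)) t
    (- polar_x (r t) (s t) - polar_y (r t) (s t) * psi (r t) (s t)).
Proof.
intros Hr Hs. destruct (polar_derive r s t _ _ Hr Hs) as [X Y].
assert (SC := sin2_cos2 (s t)). unfold Rsqr in SC.
split.
- replace (polar_y (r t) (s t)) with
   (polar_x (r t) (s t) * - (sin (s t) ^ 2 * psi (r t) (s t)) +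
    polar_y (r t) (s t) * (1 - sin (s t) * cos (s t) * psi (r t) (s t))); [exact X|].
  unfold polar_x, polar_y. ring.
- replace (- polar_x (r t) (s t) - polar_y (r t) (s t) * psi (r t) (s t)) with
   (polar_y (r t) (s t) * - (sin (s t) ^ 2 * psi (r t) (s t)) -
    polar_x (r t) (s t) * (1 - sin (s t) * cos (s t) * psi (r t) (s t))); [exact Y|].
  unfold polar_x, polar_y.
  replace (sin (s t) * cos (s t)) with (cos (s t) * sin (s t)) by ring.
  transitivity (- (exp (r t) * cos (s t)) + exp (r t) * sin (s t) * psi (r t) (s t) *
     (sin (s t) * sin (s t) + cos (s t) * cos (s t))); [ring|]. rewrite SC. ring.
Qed.

(** If [B] were finite, [g] would coincide before [B] with the global solution of
    the field truncated outside a slightly larger square.  That solution stays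
    in the square for a short time after [B], and there it continues [g]. *)
Lemma bounded_solution_extends (A B : Rbar) (g : R -> R * R) (t0 M : R) :
  maximal_solution (planar_field phi) A B g -> in_oint A B t0 ->
  (forall t, t0 <= t -> in_oint A B t ->
     Rabs (fst (g t)) <= M /\ Rabs (snd (g t)) <= M) ->
  B = p_infty.
Proof.
intros [HAB [Hg Hmax]] I0 HM.
destruct B as [T| |]; [exfalso|reflexivity|now destruct I0].
assert (M0 : 0 <= M).
{ destruct (HM t0 (Rle_refl _) I0) as [H _]. generalize (Rabs_pos (fst (g t0))). lra. }
set (N := M + 1). set (cl := clamp (- N) N).
assert (cl_id : forall z, Rabs z <= N -> cl z = z).
{ intros z Hz. apply clamp_id. now apply Rabs_le_between. }
assert (bl_cl : bdd_lipschitz (fun x _ => cl x)).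
{ apply (bl_clamped (fun z => z) (fun _ => 1) (- N) N 1); [unfold N; lra|].
  intros t _. split; [apply @is_derive_id|rewrite Rabs_R1; lra]. }
set (G1 := fun _ y : R => cl y).
set (G2 := fun x y : R => - cl x - cl y * phi (cl x) (cl y)).
assert (BG1 : bdd_lipschitz G1) by exact (bl_swap _ bl_cl).
assert (BG2 : bdd_lipschitz G2).
{ apply bl_minus; [exact (bl_opp _ bl_cl)|]. apply bl_mult; [exact (bl_swap _ bl_cl)|].
  apply phi_clamped_bl; [exact phi_C1|unfold N; lra]. }
destruct (picard G1 G2 (fst (g t0)) (snd (g t0)) BG1 BG2) as [X [Y [X0 [Y0 HXY]]]].
set (x := fun t => X (t - t0)). set (y := fun t => Y (t - t0)).
assert (Dxy : forall t, is_derive x t (G1 (x t) (y t)) /\ is_derive y t (G2 (x t) (y t))).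
{ intros t. destruct (HXY (t - t0)) as [DX DY]. unfold x, y. split.
  - auto_derive; [eexists; exact DX|].
    change (Derive (fun z => X z) (t + - t0)) with (Derive X (t - t0)).
    rewrite (is_derive_unique X _ _ DX). ring.
  - auto_derive; [eexists; exact DY|].
    change (Derive (fun z => Y z) (t + - t0)) with (Derive Y (t - t0)).
    rewrite (is_derive_unique Y _ _ DY). ring. }
assert (agree : forall t, t0 <= t < T -> g t = (x t, y t)).
{ intros t Ht.
  assert (It : in_oint A T t).
  { split; [|simpl; lra]. apply Rbar_lt_le_trans with t0; [apply I0|simpl; lra]. }
  destruct (ode_unique G1 G2 (fun t => fst (g t)) (fun t => snd (g t)) x y t0 t BG1 BG2)
    as [E1 E2].
  - intros u Hu. assert (Iu := in_oint_between A T t0 t u I0 It Hu).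
    rewrite Rmin_left in Hu by lra.
    destruct (HM u ltac:(lra) Iu) as [B1 B2].
    destruct (Hg u Iu) as [D1 D2]. unfold G1, G2.
    rewrite !cl_id by (unfold N; lra). split; assumption.
  - intros; apply Dxy.
  - unfold x. rewrite Rminus_diag, X0. reflexivity.
  - unfold y. rewrite Rminus_diag, Y0. reflexivity.
  - rewrite (surjective_pairing (g t)). simpl in E1, E2. now rewrite E1, E2. }
assert (LT : t0 < T) by apply I0.
assert (near : forall (f h : R -> R), (forall t, is_derive f t (h t)) ->
   (forall t, t0 <= t < T -> Rabs (f t) <= M) ->
   exists eta : posreal, forall t, Rabs (t - T) < eta -> Rabs (f t) <= N).
{ intros f h Hd Hb.
  assert (C := is_derive_continuity_pt _ _ _ (Hd T)).
  destruct (proj1 (continuity_pt_locally f T) C (mkposreal (/ 2) ltac:(lra))) as [eta He].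
  exists eta. intros t Ht. simpl in He.
  set (u := Rmax t0 (T - eta / 2)).
  assert (Pe := cond_pos eta).
  assert (u1 : t0 <= u) by apply Rmax_l. assert (u2 : T - eta / 2 <= u) by apply Rmax_r.
  assert (u3 : u < T) by (apply Rmax_lub_lt; lra).
  assert (H1 : Rabs (f u - f T) < / 2).
  { apply He. change (Rabs (u - T) < eta). apply Rabs_def1; lra. }
  assert (H2 : Rabs (f t - f T) < / 2) by (apply He; exact Ht).
  assert (H3 := Hb u (conj u1 u3)).
  apply Rabs_def2 in H1. apply Rabs_def2 in H2. apply Rabs_le_between in H3.
  apply Rabs_le. unfold N. lra. }
assert (inside : forall t, t0 <= t < T -> Rabs (x t) <= M /\ Rabs (y t) <= M).
{ intros t Ht. assert (It : in_oint A T t).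
  { split; [|simpl; lra]. apply Rbar_lt_le_trans with t0; [apply I0|simpl; lra]. }
  generalize (HM t ltac:(lra) It). now rewrite agree. }
destruct (near x _ (fun t => proj1 (Dxy t))) as [e1 He1]; [apply inside|].
destruct (near y _ (fun t => proj2 (Dxy t))) as [e2 He2]; [apply inside|].
set (eta := Rmin e1 e2).
assert (Pe : 0 < eta) by (apply Rmin_glb_lt; apply cond_pos).
set (h := fun t => if Rlt_dec t T then g t else (x t, y t)).
assert (Heq : forall t, t0 <= t -> h t = (x t, y t)).
{ intros t Ht. unfold h. destruct (Rlt_dec t T); [|reflexivity].
  apply agree. lra. }
destruct (Hmax A (T + eta) h) as [_ E].
- apply Rbar_le_refl.
- simpl. lra.
- intros t [At Bt]. simpl in Bt. destruct (Rlt_dec t T) as [Ht|Ht].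
  + destruct (Hg t) as [D1 D2]; [now split|].
    assert (L : locally t (fun u => g u = h u)).
    { generalize (open_lt T t Ht). apply filter_imp. intros u Hu.
      unfold h. now destruct (Rlt_dec u T). }
    rewrite <- (locally_singleton _ _ L).
    split.
    * apply (is_derive_ext_loc (fun s => fst (g s))); [|exact D1].
      revert L. apply filter_imp. intros u ->. reflexivity.
    * apply (is_derive_ext_loc (fun s => snd (g s))); [|exact D2].
      revert L. apply filter_imp. intros u ->. reflexivity.
  + assert (L : locally t (fun u => (x u, y u) = h u)).
    { generalize (open_gt t0 t ltac:(simpl; lra)). apply filter_imp. intros u Hu.
      symmetry. apply Heq. simpl in Hu. lra. }
    assert (V : Rabs (t - T) < eta) by (apply Rabs_def1; lra).
    assert (x1 : Rabs (x t) <= N) by (apply He1; eapply Rlt_le_trans; [exact V|apply Rmin_l]).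
    assert (y1 : Rabs (y t) <= N) by (apply He2; eapply Rlt_le_trans; [exact V|apply Rmin_r]).
    destruct (Dxy t) as [D1 D2]. unfold G1, G2 in D1, D2.
    rewrite (cl_id (y t) y1) in D1. rewrite (cl_id (x t) x1), (cl_id (y t) y1) in D2.
    rewrite Heq by lra.
    split.
    * apply (is_derive_ext_loc x); [|exact D1].
      revert L. apply filter_imp. intros u <-. reflexivity.
    * apply (is_derive_ext_loc y); [|exact D2].
      revert L. apply filter_imp. intros u <-. reflexivity.
- intros t [_ Ht]. unfold h. simpl in Ht. now destruct (Rlt_dec t T).
- injection E. lra.
Qed.

End Orbits.

(** * The gap to the cycle as a Lyapunov function *)

Lemma dist_to_set_le (C : R * R -> Prop) (p q : R * R) :
  C q -> 0 <= dist_to_set C p <= dist_euc (fst p) (snd p) (fst q) (snd q).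
Proof.
intros Hq. unfold dist_to_set.
set (E := fun d => exists q, C q /\ d = dist_euc (fst p) (snd p) (fst q) (snd q)).
destruct (Glb_Rbar_correct E) as [H1 H2].
assert (U := H1 _ (ex_intro _ q (conj Hq eq_refl))).
assert (L : Rbar_le 0 (Glb_Rbar E)).
{ apply H2. intros d [q' [_ ->]]. simpl. unfold dist_euc. apply sqrt_pos. }
destruct (Glb_Rbar E) as [l| |]; simpl in *; [now split|easy|easy].
Qed.

Section Cycle.

Variable phi : R -> R -> R.
Hypothesis phi_C1 : is_C1 phi.
Hypothesis phi_star : strictly_star_shaped phi.
Variables a b : R.
Hypothesis psi_neg : forall r s, r <= a -> polar_phi phi r s < 0.
Hypothesis psi_nonneg : forall r s, b <= r -> 0 <= polar_phi phi r s.
Variables (rho : R -> R) (e : R).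
Hypothesis cycle : star_cycle phi a b rho e.

Notation psi := (polar_phi phi).
Notation beta := (angular_speed phi rho).

Definition cycle_curve (p : R * R) : Prop :=
  exists s, p = (polar_x (rho s) s, polar_y (rho s) s).

(** In [r' - rho' * s'] the products of two values of [psi] cancel, which leaves
    a multiple of their difference. *)
Lemma cycle_gap_derive (g : R -> R * R) (r s : R -> R) (t : R) :
  polar_lift phi g r s t ->
  is_derive (fun t => r t - rho (s t)) t
    (- (sin (s t) ^ 2 * (psi (r t) (s t) - psi (rho (s t)) (s t))) / beta (s t)).
Proof.
intros [_ [Hr Hs]]. destruct cycle as [He [_ [_ [Hb Hd]]]].
assert (D := Hd (s t)). assert (B := Hb (s t)).
assert (C := is_derive_comp rho s t _ _ D Hs).
assert (X := is_derive_minus _ _ _ _ _ Hr C).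
replace (- (sin (s t) ^ 2 * (psi (r t) (s t) - psi (rho (s t)) (s t))) / beta (s t))
  with (minus (- (sin (s t) ^ 2 * psi (r t) (s t)))
   (scal (1 - sin (s t) * cos (s t) * psi (r t) (s t))
      (- (sin (s t) ^ 2 * psi (rho (s t)) (s t)) / beta (s t)))); [exact X|].
unfold minus, plus, opp, scal; simpl; unfold mult; simpl.
unfold angular_speed in *. field. lra.
Qed.

Lemma cycle_gap_sq_derive (g : R -> R * R) (r s : R -> R) (t : R) :
  polar_lift phi g r s t ->
  is_derive (fun t => (r t - rho (s t)) ^ 2) t
    (- (2 * sin (s t) ^ 2 / beta (s t) *
        ((r t - rho (s t)) * (psi (r t) (s t) - psi (rho (s t)) (s t))))).
Proof.
intros H. assert (D := cycle_gap_derive g r s t H).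
destruct cycle as [He [_ [_ [Hb _]]]]. assert (B := Hb (s t)).
assert (gen : forall (f : R -> R) l, is_derive f t l ->
  is_derive (fun t => f t ^ 2) t (2 * f t * l)).
{ intros f l Hf. auto_derive; [now exists l|].
  change (Derive (fun x => f x) t) with (Derive f t).
  rewrite (is_derive_unique f _ _ Hf). ring. }
assert (X := gen _ _ D). simpl in X.
match goal with |- is_derive _ _ ?l =>
  match type of X with is_derive _ _ ?l' => replace l with l' by (field; lra) end end.
exact X.
Qed.

Lemma cycle_gap_decr (g : R -> R * R) (r s : R -> R) (u v : R) :
  u <= v -> (forall t, u <= t <= v -> polar_lift phi g r s t) ->
  Rabs (r v - rho (s v)) <= Rabs (r u - rho (s u)).
Proof.
intros Huv H. apply Rsqr_le_abs_0. rewrite !Rsqr_pow2.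
apply (nonincreasing_of_derive (fun t => (r t - rho (s t)) ^ 2) _ u v Huv
  (fun t Ht => cycle_gap_sq_derive g r s t (H t Ht))).
intros t Ht. destruct cycle as [He [_ [_ [Hb _]]]]. assert (B := Hb (s t)).
assert (P : 0 <= 2 * sin (s t) ^ 2 / beta (s t)).
{ apply Rdiv_le_0_compat; [|lra]. generalize (pow2_ge_0 (sin (s t))). lra. }
assert (Q : 0 <= (r t - rho (s t)) * (psi (r t) (s t) - psi (rho (s t)) (s t))).
{ destruct (Rle_dec (r t) (rho (s t))) as [L|L].
  - assert (X := psi_incr phi phi_C1 phi_star a b psi_neg psi_nonneg _ _ (s t) L). nra.
  - assert (X := psi_incr phi phi_C1 phi_star a b psi_neg psi_nonneg
      (rho (s t)) (r t) (s t) ltac:(lra)). nra. }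
generalize (Rmult_le_pos _ _ P Q). lra.
Qed.

(** The gap to the cycle does not increase, so the distance to the origin stays
    bounded. *)
Lemma maximal_solution_global (A B : Rbar) (g : R -> R * R) :
  maximal_solution (planar_field phi) A B g -> non_constant_on A B g ->
  B = p_infty.
Proof.
intros Hm Hn.
destruct (polar_lift_exists phi phi_C1 A B g) as [r [s H]]; [apply Hm|exact Hn|].
destruct Hn as [t0 [_ [I0 _]]].
destruct cycle as [_ [_ [Hab _]]].
set (d := Rabs (r t0 - rho (s t0))).
apply (bounded_solution_extends phi phi_C1 A B g t0 (exp (b + d)) Hm I0).
intros t Ht It.
assert (G := cycle_gap_decr g r s t0 t Ht).
destruct (H t It) as [Eg _].
assert (Rb : r t <= b + d).
{ assert (G' : Rabs (r t - rho (s t)) <= d).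
  { apply G. intros u Hu. apply H. apply (in_oint_between A B t0 t); auto.
    now rewrite Rmin_left, Rmax_right. }
  apply Rabs_le_between in G'. generalize (Hab (s t)). lra. }
apply exp_nondecreasing in Rb. assert (P := exp_pos (r t)).
rewrite Eg. unfold polar_x, polar_y. simpl.
rewrite Rabs_Ropp, !Rabs_mult, (Rabs_pos_eq (exp (r t))) by lra.
assert (S : Rabs (sin (s t)) <= 1) by (apply Rabs_le; generalize (SIN_bound (s t)); lra).
assert (C : Rabs (cos (s t)) <= 1) by (apply Rabs_le; generalize (COS_bound (s t)); lra).
split; nra.
Qed.

(** Suppose that the gap keeps at least the size [eps].  Then [V], its square,
    satisfies [V' <= - c * sin s ^ 2] for some [c > 0], while
    [(sin s * cos s)' >= 1/2 - L * sin s ^ 2] for some [L].  Hence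
    [L / c * V - sin s * cos s] decreases at rate at least [1/2] for ever, yet it
    is bounded below by [-1]. *)
Lemma cycle_gap_vanishes (g : R -> R * R) (r s : R -> R) (t0 : R) :
  (forall t, t0 <= t -> polar_lift phi g r s t) ->
  forall eps, 0 < eps -> exists T, forall t, T <= t -> Rabs (r t - rho (s t)) < eps.
Proof.
intros H eps Heps.
enough (X : exists T, t0 <= T /\ Rabs (r T - rho (s T)) < eps).
{ destruct X as [T [HT XT]]. exists T. intros t Ht.
  eapply Rle_lt_trans; [|exact XT]. apply (cycle_gap_decr g); [exact Ht|].
  intros u Hu. apply H. lra. }
apply NNPP. intros Hno.
assert (far : forall t, t0 <= t -> eps <= Rabs (r t - rho (s t))).
{ intros t Ht. apply Rnot_lt_le. intros L. apply Hno. now exists t. }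
clear Hno.
destruct cycle as [He [_ [Hab [Hb _]]]].
set (d := Rabs (r t0 - rho (s t0))).
assert (range : forall t, t0 <= t -> a - d <= r t <= b + d).
{ intros t Ht. assert (G : Rabs (r t - rho (s t)) <= d).
  { apply (cycle_gap_decr g); [exact Ht|]. intros u Hu. apply H. lra. }
  apply Rabs_le_between in G. generalize (Hab (s t)). lra. }
assert (d0 : 0 <= d) by apply Rabs_pos.
destruct (psi_strong_monotone phi phi_C1 phi_star a b psi_neg psi_nonneg (a - d) (b + d))
  as [m [Hm [_ Hmono]]].
destruct (psi_bounded phi phi_C1 (a - d) (b + d)) as [K [K1 HK]].
assert (bmax : forall u, beta u <= 1 + K).
{ intros u. unfold angular_speed.
  destruct (HK (rho u) u) as [B1 _]; [generalize (Hab u); lra|].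
  assert (S := SIN_bound u). assert (C := COS_bound u).
  assert (SC := sin2_cos2 u). unfold Rsqr in SC.
  apply Rabs_le_between in B1.
  assert (-1 <= sin u * cos u <= 1) by nra. nra. }
set (c := 2 * m * eps ^ 2 / (1 + K)).
assert (eps2 : 0 < eps ^ 2) by (apply pow_lt; lra).
assert (Hc : 0 < c).
{ apply Rdiv_lt_0_compat; [|lra]. apply Rmult_lt_0_compat; lra. }
set (L := K ^ 2 / 2 + 2 + 2 * K).
set (V := fun t => (r t - rho (s t)) ^ 2).
set (F := fun t => L / c * V t - sin (s t) * cos (s t) + t / 2).
assert (L0 : 0 <= L / c).
{ apply Rdiv_le_0_compat; [|exact Hc]. unfold L. generalize (pow2_ge_0 K). lra. }
set (dV := fun t => - (2 * sin (s t) ^ 2 / beta (s t) *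
        ((r t - rho (s t)) * (psi (r t) (s t) - psi (rho (s t)) (s t))))).
set (ds := fun t => 1 - sin (s t) * cos (s t) * psi (r t) (s t)).
assert (dF : forall t, t0 <= t ->
  is_derive F t (L / c * dV t - (cos (s t) ^ 2 - sin (s t) ^ 2) * ds t + / 2)).
{ intros t Ht. assert (X := cycle_gap_sq_derive g r s t (H t Ht)).
  fold (dV t) in X. destruct (H t Ht) as [_ [_ Y]]. fold (ds t) in Y.
  change (is_derive V t (dV t)) in X.
  unfold F. revert X Y. generalize (dV t), (ds t). clearbody V.
  intros v w X Y.
  auto_derive; [split; [now exists v|split; [now exists w|split; [now exists w|exact I]]]|].
  change (Derive (fun x => V x) t) with (Derive V t).
  change (Derive (fun x => s x) t) with (Derive s t).
  rewrite (is_derive_unique V _ _ X), (is_derive_unique s _ _ Y). field. lra. }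
assert (sF : forall t, t0 <= t ->
  L / c * dV t - (cos (s t) ^ 2 - sin (s t) ^ 2) * ds t + / 2 <= 0).
{ intros t Ht.
  assert (A1 : dV t <= - (c * sin (s t) ^ 2)).
  { unfold dV. apply Ropp_le_contravar.
    assert (M := Hmono (r t) (rho (s t)) (s t) (range t Ht)
       ltac:(generalize (Hab (s t)); lra)).
    assert (E2 : eps ^ 2 <= (r t - rho (s t)) ^ 2).
    { rewrite <- (pow2_abs (r t - rho (s t))). apply pow_incr.
      generalize (far t Ht). lra. }
    assert (M' : m * eps ^ 2 <=
       (r t - rho (s t)) * (psi (r t) (s t) - psi (rho (s t)) (s t))).
    { eapply Rle_trans; [|exact M]. apply Rmult_le_compat_l; lra. }
    assert (B1 := bmax (s t)). assert (B0 := Hb (s t)).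
    replace (c * sin (s t) ^ 2) with
      (2 * sin (s t) ^ 2 * / (1 + K) * (m * eps ^ 2)) by (unfold c; field; lra).
    assert (S2 := pow2_ge_0 (sin (s t))).
    assert (I1 : / (1 + K) <= / beta (s t)) by (apply Rinv_le_contravar; lra).
    assert (I0 : 0 < / (1 + K)) by (apply Rinv_0_lt_compat; lra).
    apply Rmult_le_compat; [|apply Rmult_le_pos; lra| |exact M'].
    - apply Rmult_le_pos; lra.
    - apply Rmult_le_compat_l; lra. }
  assert (A2 : L / c * dV t <= - (L * sin (s t) ^ 2)).
  { apply Rle_trans with (L / c * - (c * sin (s t) ^ 2)).
    - now apply Rmult_le_compat_l.
    - right. field. lra. }
  assert (A3 : / 2 - L * sin (s t) ^ 2 <= (cos (s t) ^ 2 - sin (s t) ^ 2) * ds t).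
  { unfold ds, L. destruct (HK (r t) (s t) (range t Ht)) as [B1 _].
    assert (SC := sin2_cos2 (s t)). unfold Rsqr in SC.
    revert B1 SC. generalize (psi (r t) (s t)), (sin (s t)), (cos (s t)).
    intros q z w B1 SC.
    replace (w ^ 2 - z ^ 2) with (1 - 2 * z ^ 2) by lra.
    assert (Q1 : (z * w * q) ^ 2 <= z ^ 2 * K ^ 2).
    { replace ((z * w * q) ^ 2) with (z ^ 2 * (w ^ 2 * q ^ 2)) by ring.
      apply Rmult_le_compat_l; [apply pow2_ge_0|].
      assert (q ^ 2 <= K ^ 2).
      { rewrite <- (pow2_abs q). apply pow_incr. generalize (Rabs_pos q). lra. }
      assert (0 <= q ^ 2) by apply pow2_ge_0. nra. }
    assert (Q2 : -1 <= z * w <= 1) by nra.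
    apply Rabs_le_between in B1.
    assert (Q3 : - K <= z * w * q <= K) by nra.
    revert Q1 Q3. generalize (z * w * q). intros p Q1 Q3.
    assert (Q4 : p <= / 2 + z ^ 2 * K ^ 2 / 2).
    { generalize (pow2_ge_0 (p - 1)). lra. }
    assert (Q5 : z ^ 2 * (1 - p) <= z ^ 2 * (1 + K)).
    { apply Rmult_le_compat_l; [apply pow2_ge_0|lra]. }
    lra. }
  lra. }
(* At this time the term [t / 2] of [F] alone exceeds [F t0 + 1]. *)
set (T := t0 + 2 * (Rabs (F t0) + Rabs t0 + 2)).
assert (HT : t0 <= T).
{ unfold T. generalize (Rabs_pos (F t0)) (Rabs_pos t0). lra. }
assert (X := nonincreasing_of_derive F _ t0 T HT (fun t Ht => dF t (proj1 Ht))
  (fun t Ht => sF t (proj1 Ht))).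
assert (V0 : 0 <= L / c * V T) by (apply Rmult_le_pos; [exact L0|apply pow2_ge_0]).
assert (E1 : sin (s T) * cos (s T) <= 1).
{ assert (SC := sin2_cos2 (s T)). unfold Rsqr in SC. nra. }
unfold F at 1 in X. assert (Y := Rle_abs (F t0)).
assert (Z := Rle_abs (- t0)). rewrite Rabs_Ropp in Z. generalize (Rabs_pos t0). unfold T in *. lra.
Qed.

(** The point of the curve on the same ray lies at distance
    [exp (rho s) * |exp (r - rho s) - 1|]. *)
Lemma cycle_attracts (A : Rbar) (g : R -> R * R) :
  solution_on (planar_field phi) A p_infty g -> non_constant_on A p_infty g ->
  attracts cycle_curve g.
Proof.
intros Hg Hn. destruct (polar_lift_exists phi phi_C1 A p_infty g Hg Hn) as [r [s H]].
destruct Hn as [t0 [_ [[A0 _] _]]].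
assert (lift : forall t, t0 <= t -> polar_lift phi g r s t).
{ intros t Ht. apply H. split; [|exact I].
  apply Rbar_lt_le_trans with t0; [exact A0|exact Ht]. }
assert (C := derivable_continuous_pt _ _ (derivable_pt_exp 0)).
assert (Pb := exp_pos b).
apply is_lim_spec. intros eps.
destruct (proj1 (continuity_pt_locally exp 0) C
  (mkposreal (eps / exp b) (Rdiv_lt_0_compat _ _ (cond_pos eps) Pb))) as [d Hd].
simpl in Hd.
destruct (cycle_gap_vanishes g r s t0 lift d (cond_pos d)) as [T HT].
exists (Rmax T t0). intros t Ht.
assert (t1 : T <= t) by (generalize (Rmax_l T t0); lra).
assert (t2 : t0 <= t) by (generalize (Rmax_r T t0); lra).
destruct (lift t t2) as [Eg _].
destruct (dist_to_set_le cycle_curve (g t)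
  (polar_x (rho (s t)) (s t), polar_y (rho (s t)) (s t))) as [D0 D1].
{ now exists (s t). }
rewrite Rminus_0_r, Rabs_pos_eq by exact D0.
eapply Rle_lt_trans; [exact D1|]. rewrite Eg. simpl.
assert (Ed : dist_euc (polar_x (r t) (s t)) (polar_y (r t) (s t))
   (polar_x (rho (s t)) (s t)) (polar_y (rho (s t)) (s t)) =
   Rabs (exp (r t) - exp (rho (s t)))).
{ unfold dist_euc. rewrite <- sqrt_Rsqr_abs. f_equal.
  assert (SC := sin2_cos2 (s t)). unfold Rsqr in *. unfold polar_x, polar_y.
  transitivity ((exp (r t) - exp (rho (s t))) * (exp (r t) - exp (rho (s t))) *
   (sin (s t) * sin (s t) + cos (s t) * cos (s t))); [ring|]. rewrite SC. ring. }
rewrite Ed.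
assert (X : Rabs (exp (r t - rho (s t)) - exp 0) < eps / exp b).
{ apply Hd. change (Rabs (r t - rho (s t) - 0) < d). rewrite Rminus_0_r. now apply HT. }
replace (exp (r t) - exp (rho (s t))) with
  (exp (rho (s t)) * (exp (r t - rho (s t)) - exp 0)).
2:{ rewrite exp_0, Rmult_minus_distr_l, <- exp_plus, Rmult_1_r. do 2 f_equal. ring. }
rewrite Rabs_mult, (Rabs_pos_eq (exp (rho (s t)))) by (left; apply exp_pos).
destruct cycle as [_ [_ [Hab _]]].
assert (Y : exp (rho (s t)) <= exp b) by (apply exp_nondecreasing, Hab).
apply Rle_lt_trans with (exp b * Rabs (exp (r t - rho (s t)) - exp 0)).
- apply Rmult_le_compat_r; [apply Rabs_pos|exact Y].
- apply Rlt_le_trans with (exp b * (eps / exp b)).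
  + now apply Rmult_lt_compat_l.
  + right. field. lra.
Qed.

(** The time parametrization comes from [s' = beta s]; one period is the time
    that [s] takes to grow by [2 * PI]. *)
Lemma cycle_periodic : periodic_orbit (planar_field phi) cycle_curve.
Proof.
assert (Hab := negative_radius_lt_nonneg phi a b psi_neg psi_nonneg).
assert (cycle' := cycle). destruct cycle' as [He [Per [Rab [Hb Hd]]]].
destruct (psi_bounded phi phi_C1 a b) as [K [K1 HK]].
assert (Brho : bdd_lipschitz (fun _ s => rho s)).
{ apply (bl_of_derive rho (fun t => - (sin t ^ 2 * psi (rho t) t) / beta t)
    (Rmax (Rabs a) (Rabs b)) (K / e)).
  - intros t. destruct (Rab t). now apply RmaxAbs.
  - exact Hd.
  - intros t. destruct (HK (rho t) t (Rab t)) as [B1 _]. assert (B := Hb t).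
    unfold Rdiv. rewrite Rabs_mult, Rabs_Ropp, Rabs_mult.
    apply Rmult_le_compat; [apply Rmult_le_pos; apply Rabs_pos|apply Rabs_pos| |].
    + rewrite <- (Rmult_1_l K). apply Rmult_le_compat; [apply Rabs_pos|apply Rabs_pos| |exact B1].
      rewrite Rabs_pos_eq by apply pow2_ge_0. generalize (SIN_bound t). nra.
    + rewrite Rabs_pos_eq by (left; apply Rinv_0_lt_compat; lra).
      apply Rinv_le_contravar; lra. }
assert (Bbeta : bdd_lipschitz (fun _ s => beta s)).
{ apply (bl_ext (fun _ s => 1 - sin s * cos s * psi (clamp a b (rho s)) s)).
  { intros _ s. unfold angular_speed. now rewrite clamp_id. }
  apply bl_minus; [apply bl_const|].
  apply bl_mult; [exact (bl_mult _ _ bl_sin bl_cos)|].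
  assert (P := psi_clamped_bl phi a b phi_C1 (Rlt_le _ _ Hab)).
  destruct P as [k [k0 [P1 P2]]]. destruct Brho as [k' [k0' [_ P3]]].
  apply (bl_intro _ k (k * (k' + 1))); [intros; apply P1|].
  intros x y x' y'. eapply Rle_trans; [apply P2|]. rewrite Rmult_assoc.
  apply Rmult_le_compat_l; [exact k0|].
  generalize (P3 x y x' y') (Rabs_pos (x - x')). lra. }
destruct (picard (fun _ _ => 0) (fun _ s => beta s) 0 0 (bl_const 0) Bbeta)
  as [z [s [_ [s0 Hs]]]].
assert (Ds : forall t, is_derive s t (beta (s t))) by (intros; apply Hs).
assert (surj := surjective_of_speed s (fun t => beta (s t)) e He Ds (fun t => Hb (s t))).
assert (Pbeta : forall u, beta (u + 2 * PI) = beta u).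
{ intros u. unfold angular_speed, polar_phi, polar_x, polar_y.
  destruct (sin_cos_turn u) as [-> ->]. now rewrite Per. }
exists (fun t => (polar_x (rho (s t)) (s t), polar_y (rho (s t)) (s t))).
assert (Hpi := PI_RGT_0).
split; [|split; [|split]].
- intros t _. apply (polar_lift_solution phi (fun t => rho (s t)) s t).
  + assert (C := is_derive_comp rho s t _ _ (Hd (s t)) (Ds t)).
    replace (- (sin (s t) ^ 2 * psi (rho (s t)) (s t))) with
     (scal (beta (s t)) (- (sin (s t) ^ 2 * psi (rho (s t)) (s t)) / beta (s t)));
     [exact C|].
    unfold scal; simpl; unfold mult; simpl. field. generalize (Hb (s t)). lra.
  + apply Ds.
- destruct (surj PI) as [t Ht]. exists 0, t.
  split; [now split|split; [now split|]]. rewrite s0, Ht. intros E.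
  injection E as E _. unfold polar_x in E. rewrite cos_0, cos_PI in E.
  generalize (exp_pos (rho 0)) (exp_pos (rho PI)). lra.
- destruct (surj (2 * PI)) as [T HT]. exists T. split.
  + apply Rnot_le_lt. intros L.
    assert (X := nonincreasing_of_derive (fun t => - s t) (fun t => - beta (s t)) T 0 L).
    assert (- s 0 <= - s T); [|lra]. apply X; intros t _.
    * apply (is_derive_opp s), Ds.
    * generalize (Hb (s t)). lra.
  + assert (shift : forall t, s (t + T) = s t + 2 * PI).
    { intros t.
      destruct (ode_unique (fun _ _ => 0) (fun _ s => beta s) (fun _ => 0)
        (fun t => s (t + T)) (fun _ => 0) (fun t => s t + 2 * PI) 0 t
        (bl_const 0) Bbeta) as [_ E].
      - intros u _. split; [apply @is_derive_const|].
        auto_derive; [eexists; apply Ds|].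
        change (Derive (fun z => s z) (u + T)) with (Derive s (u + T)).
        rewrite (is_derive_unique s _ _ (Ds _)). ring.
      - intros u _. split; [apply @is_derive_const|].
        rewrite Pbeta. auto_derive; [eexists; apply Ds|].
        change (Derive (fun z => s z) u) with (Derive s u).
        rewrite (is_derive_unique s _ _ (Ds _)). ring.
      - reflexivity.
      - rewrite Rplus_0_l, s0. lra.
      - exact E. }
    intros t. rewrite shift, Per. unfold polar_x, polar_y.
    destruct (sin_cos_turn (s t)) as [-> ->]. reflexivity.
- intros p. split.
  + intros [u ->]. destruct (surj u) as [t Ht]. exists t. now rewrite Ht.
  + intros [t <-]. now exists (s t).
Qed.

(** The gap to the cycle depends only on the point, because [rho] is
    [2 * PI]-periodic; on a periodic orbit it both tends to [0] and returns to
    each of its values.  Conversely the orbit covers the whole curve, since its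
    angular speed is at least [e]. *)
Lemma periodic_orbit_unique (C : R * R -> Prop) :
  periodic_orbit (planar_field phi) C -> C = cycle_curve.
Proof.
intros [g [Hg [Hn [[T [HT Hper]] HC]]]].
destruct (polar_lift_exists phi phi_C1 _ _ g Hg Hn) as [r [s H]].
assert (lift : forall t, polar_lift phi g r s t) by (intros; apply H; now split).
assert (cycle' := cycle). destruct cycle' as [He [Per [_ [Hb _]]]].
assert (pern : forall (n : nat) t, g (t + INR n * T) = g t).
{ induction n as [|n IH]; intros t.
  - f_equal. simpl. ring.
  - rewrite S_INR, <- (IH t), <- (Hper (t + INR n * T)). f_equal. ring. }
assert (on : forall t, r t = rho (s t)).
{ intros t. apply Rminus_diag_uniq. apply Rabs_eq_0.
  apply Rle_antisym; [|apply Rabs_pos]. apply Rnot_lt_le. intros Hpos.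
  destruct (cycle_gap_vanishes g r s t (fun u _ => lift u) _ Hpos) as [T1 HT1].
  destruct (nfloor_ex (Rabs (T1 - t) / T)) as [n Hn'].
  { apply Rdiv_le_0_compat; [apply Rabs_pos|exact HT]. }
  set (u := t + INR (S n) * T).
  assert (Hu : T1 <= u).
  { unfold u. rewrite S_INR. assert (X : Rabs (T1 - t) < (INR n + 1) * T).
    { replace (Rabs (T1 - t)) with (Rabs (T1 - t) / T * T) by (field; lra).
      apply Rmult_lt_compat_r; lra. }
    generalize (Rle_abs (T1 - t)). lra. }
  assert (Eg := pern (S n) t). fold u in Eg.
  destruct (lift u) as [Eu _]. destruct (lift t) as [Et _].
  rewrite Eu, Et in Eg. injection Eg as Ex Ey.
  destruct (polar_inj _ _ _ _ Ex Ey) as [Er [Ec Es]].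
  destruct (same_angle (s u) (s t) Ec Es) as [k Hk].
  assert (Erho : rho (s t) = rho (s u)) by (rewrite Hk; now apply periodic_Z).
  assert (X := HT1 u Hu). rewrite Er, <- Erho in X. lra. }
assert (surj : forall y, exists t, s t = y).
{ apply (surjective_of_speed s (fun t => beta (s t)) e He); [|intros; apply Hb].
  intros t. destruct (lift t) as [_ [_ D]]. rewrite on in D. exact D. }
apply functional_extensionality. intros p. apply propositional_extensionality.
rewrite HC. split.
- intros [t <-]. exists (s t). destruct (lift t) as [E _]. now rewrite E, on.
- intros [u ->]. destruct (surj u) as [t Ht]. exists t.
  destruct (lift t) as [E _]. now rewrite E, on, Ht.
Qed.

End Cycle.

Lemma psi_neg_near_0 (phi : R -> R -> R) :
  is_C1 phi -> phi 0 0 < 0 -> exists a, forall r s, r <= a -> polar_phi phi r s < 0.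
Proof.
intros HC H0. destruct (HC 0 0) as [C _].
destruct (C (mkposreal (- phi 0 0) ltac:(lra))) as [d Hd]. simpl in Hd.
assert (Pd := cond_pos d).
exists (ln (d / 2)). intros r s Hr.
apply exp_nondecreasing in Hr. rewrite exp_ln in Hr by lra.
assert (P := exp_pos r).
assert (S := SIN_bound s). assert (K := COS_bound s).
assert (X : Rabs (phi (polar_x r s) (polar_y r s) - phi 0 0) < - phi 0 0).
{ apply Hd; unfold polar_x, polar_y; apply Rabs_def1; nra. }
apply Rabs_def2 in X. unfold polar_phi. lra.
Qed.

Lemma psi_nonneg_far (phi : R -> R -> R) (U : R * R -> Prop) (sigma : R) :
  is_lub (radii U) sigma -> (forall x y, ~ U (x, y) -> 0 <= phi x y) ->
  exists b, forall r s, b <= r -> 0 <= polar_phi phi r s.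
Proof.
intros [Hub _] HU. exists (ln (Rabs sigma + 1)). intros r s Hr.
assert (P := Rabs_pos sigma).
apply exp_nondecreasing in Hr. rewrite exp_ln in Hr by lra.
apply HU. intros HUp.
assert (X := Hub _ (ex_intro _ _ (ex_intro _ _ (conj HUp eq_refl)))).
rewrite polar_norm, sqrt_pow2 in X by (left; apply exp_pos).
generalize (Rle_abs sigma). lra.
Qed.

Theorem theorem2 (phi : R -> R -> R) (U : R * R -> Prop) (sigma : R)
  (phi_C1 : is_C1 phi)
  (phi_star : strictly_star_shaped phi)
  (phi_neg : phi 0 0 < 0)
  (U_bounded : bounded_set U)
  (sigma_sup : is_lub (radii U) sigma)
  (phi_nonneg : forall x y, ~ U (x, y) -> 0 <= phi x y)
  (phi_circle : forall r, sigma < r ->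
     ~ (forall x y, x ^ 2 + y ^ 2 = r ^ 2 -> phi x y = 0)) :
  exists C : R * R -> Prop,
    unique (limit_cycle (planar_field phi)) C /\
    forall (a b : Rbar) (gamma : R -> R * R),
      maximal_solution (planar_field phi) a b gamma ->
      non_constant_on a b gamma ->
      b = p_infty /\ attracts C gamma.
Proof.
destruct (psi_neg_near_0 phi phi_C1 phi_neg) as [a Ha].
destruct (psi_nonneg_far phi U sigma sigma_sup phi_nonneg) as [b Hb].
destruct (star_cycle_exists phi phi_C1 phi_star a b Ha Hb) as [rho [e cycle]].
exists (cycle_curve rho). split; [split|].
- split; [eapply cycle_periodic; eassumption|].
  exists (fun _ => True). split; [apply open_true|split; [auto|]].
  intros C' HC' _. eapply periodic_orbit_unique; eassumption.
- intros C' [HC' _]. symmetry. eapply periodic_orbit_unique; eassumption.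
- intros A B g Hm Hn.
  assert (EB : B = p_infty) by (eapply maximal_solution_global; eassumption).
  subst B. split; [reflexivity|].
  eapply cycle_attracts; try eassumption. apply Hm.
Qed.
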